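(* Let $r=2l$ with $l\ge 1$, let $N\ge 2$, let $G_r=\mathrm{GL}_N(\mathcal{O}_r)$, and let $\chi$ be a stable irreducible complex character of $G_r$ above $\psi_M$, where $\psi_M$ (with $M\in \mathrm{M}_N(\mathcal{O}_l)$) is an irreducible character of $K^l$. Then: (1) $\psi_M$ extends to a character $\tilde\psi_M$ of the stabilizer $G_r(\psi_M)$ of $\psi_M$ in $G_r$. (2) There is an irreducible character $\rho$ of $G_r(\psi_M)/K^l$ (viewed by inflation as a character of $G_r(\psi_M)$) such that $\chi=\mathrm{Ind}_{G_r(\psi_M)}^{G_r}(\tilde\psi_M\,\rho)$.
   Context: Rings. $\mathcal{O}$ is the ring of integers of a non-Archimedean local field $F$ (so $\mathcal{O}$ is a complete discrete valuation ring with finite residue field), $\mathfrak{p}$ its maximal ideal, $\pi$ a fixed generator of $\mathfrak{p}$, $k=\mathcal{O}/\mathfrak{p}=\mathbb{F}_q$ of characteristic $p$, and $\mathcal{O}_s=\mathcal{O}/\mathfrak{p}^s$ for $s\ge1$. $\mu:k\to\mathcal{O}$ is the multiplicative section of the reduction map $\mathcal{O}\to k$ (so $\mu(ab)=\mu(a)\mu(b)$), and $\mu_s:k\to\mathcal{O}_s$ is its composite with $\mathcal{O}\to\mathcal{O}_s$; it is applied entrywise to matrices. Bars denote reduction mod $\mathfrak{p}$. Groups. $K^l=\ker(\mathrm{GL}_N(\mathcal{O}_r)\to \mathrm{GL}_N(\mathcal{O}_l))=I+\mathfrak{p}^l\mathrm{M}_N(\mathcal{O}_r)$. Characters of $K^l$.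 Fix an additive character $\psi:F\to\mathbb{C}^\times$ trivial on $\mathcal{O}$ but not on $\mathfrak{p}^{-1}$. For $r=2l$ and $M\in\mathrm{M}_N(\mathcal{O}_l)$ put $\psi_M(I+\pi^l x)=\psi(\pi^{-l}\,\mathrm{tr}(Mx))$ for $x\in \mathrm{M}_N(\mathcal{O}_r)$ (computed with any lifts of $M$, $x$ to $\mathcal{O}$). The map $M\mapsto\psi_M$ is a bijection from $\mathrm{M}_N(\mathcal{O}_l)$ to $\mathrm{Irr}(K^l)$. The stabilizer is $G_r(\psi_M)=\{g\in G_r: \psi_M(gxg^{-1})=\psi_M(x)\ \forall x\in K^l\}$. Jordan canonical form. Over a ring $R$, $J_n(\lambda)$ is the $n\times n$ matrix with all diagonal entries $\lambda\in R$, entries just above the diagonal equal to $1$, and all other entries $0$. A matrix over $R$ is in Jordan canonical form if it is block-diagonal with each diagonal block of the form $J_n(\lambda)$. Stable matrices. $M\in\mathrm{M}_N(\mathcal{O}_s)$ is stable if, possibly after passing to an unramified extension $\hat{\mathcal{O}}_s$ of $\mathcal{O}_s$ (i.e. $\hat{\mathcal{O}}_s=\hat{\mathcal{O}}/\pi^s\hat{\mathcal{O}}$ with $\hat{\mathcal{O}}$ the ring of integers of a finite unramified extension of $F$), $M$ is conjugate under $\mathrm{GL}_N(\hat{\mathcal{O}}_s)$ to a matrix $A+\pi B$ with entries in $\hat{\mathcal{O}}_s$ such that $A$ is in Jordan canonical form, $A=\hat\mu_s(\bar A)$ (where $\hat\mu_s$ is the multiplicative section for $\hat{\mathcal{O}}_s$,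 applied entrywise), and $B\in Z(C_{\mathrm{M}_N(\hat{\mathcal{O}}_s)}(A))$, the center of the centralizer of $A$. Stable characters. An irreducible character $\chi$ of $G_r$ is above $\psi_M$ if $\psi_M$ is a constituent of $\chi|_{K^l}$; $\chi$ is stable if it is above some $\psi_M$ with $M$ a stable matrix. *)

(* Defs.v *)
From HB Require Import structures.
From mathcomp Require Import all_boot all_order all_algebra all_fingroup.
From mathcomp Require Import all_solvable all_field all_character.

Set Implicit Arguments.
Unset Strict Implicit.
Unset Printing Implicit Defensive.

Import Order.TTheory GRing.Theory Num.Theory.
Local Open Scope ring_scope.
Local Open Scope quotient_scope.

(* val_ge v n x means v(x) >= n, with the convention v(0) = +oo; the value of  *)
(* v at 0 is irrelevant throughout.                                           *)
Definition val_ge (F : fieldType) (v : F -> int) (n : int) (x : F) : bool :=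
  (x == 0) || (n <= v x).

(* A non-Archimedean local field structure on F: a normalized discrete        *)
(* valuation for which F is complete and the residue field is finite; lreps   *)
(* is a finite list containing a representative of every residue class.       *)
Record localField (F : fieldType) := LocalField {
  lval : F -> int;
  lvalM : forall x y, x != 0 -> y != 0 -> lval (x * y) = lval x + lval y;
  lvalD : forall n x y,
    val_ge lval n x -> val_ge lval n y -> val_ge lval n (x + y);
  lval_surj : exists x, (x != 0) && (lval x == 1);
  lval_complete : forall u : nat -> F,
    (forall n : int, exists m : nat, forall i j : nat,
        (m <= i)%N -> (m <= j)%N -> val_ge lval n (u i - u j)) ->
    exists x : F, forall n : int, exists m : nat, forall i : nat,
        (m <= i)%N -> val_ge lval n (u i - x);
  lreps : seq F;
  lrepsP : forall x, val_ge lval 0 x ->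
    exists2 y, y \in lreps & val_ge lval 0 y && val_ge lval 1 (x - y)
}.

Section ValuationRing.
Variables (F : fieldType) (K : localField F).
Local Notation v := (lval K).

Lemma lval1 : v 1 = 0.
Proof.
have := lvalM K (oner_neq0 F) (oner_neq0 F).
by rewrite mulr1 => /eqP; rewrite -subr_eq0 opprD addNKr oppr_eq0 => /eqP.
Qed.

Lemma lvalN x : v (- x) = v x.
Proof.
have N1 : (-1 : F) != 0 by rewrite oppr_eq0 oner_neq0.
have vN1 : v (-1) = 0.
  have := lvalM K N1 N1; rewrite mulrNN mulr1 lval1 => /esym/eqP.
  by rewrite -mulr2n mulrn_eq0 /= => /eqP.
case: (eqVneq x 0) => [->|x0]; first by rewrite oppr0.
by rewrite -mulN1r lvalM // vN1 add0r.
Qed.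

Lemma val_geN n x : val_ge v n (- x) = val_ge v n x.
Proof. by rewrite /val_ge oppr_eq0 lvalN. Qed.

Lemma val_geB n x y : val_ge v n x -> val_ge v n y -> val_ge v n (x - y).
Proof. by move=> hx hy; apply: lvalD => //; rewrite val_geN. Qed.

Lemma val_geM m n x y :
  val_ge v m x -> val_ge v n y -> val_ge v (m + n) (x * y).
Proof.
rewrite /val_ge mulf_eq0; case: (eqVneq x 0) => //= x0.
by case: (eqVneq y 0) => //= y0 hx hy; rewrite lvalM // lerD.
Qed.

Lemma val_geW m n x : m <= n -> val_ge v n x -> val_ge v m x.
Proof. by rewrite /val_ge => mn /orP[->//|/(le_trans mn)->]; rewrite orbT. Qed.

Definition integral : {pred F} := [pred x | val_ge v 0 x].

Lemma integral_subring : subring_closed integral.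
Proof.
split=> [|x y|x y]; rewrite !inE.
- by rewrite /val_ge lval1 lexx orbT.
- exact: val_geB.
- by move=> hx hy; rewrite -[0]addr0; apply: val_geM.
Qed.

HB.instance Definition _ := GRing.isSubringClosed.Build F integral
  integral_subring.

Record intring := IntRing {intval :> F; _ : intval \in integral}.

HB.instance Definition _ := [isSub for intval].
HB.instance Definition _ := [Choice of intring by <:].
HB.instance Definition _ := [SubChoice_isSubComNzRing of intring by <:].

Definition pideal (s : nat) : {pred intring} :=
  [pred x | val_ge v s.-1.+1 (val x)].

Lemma pideal_idealr s : idealr_closed (pideal s).
Proof.
split.
- by rewrite inE /val_ge eqxx.
- by rewrite inE /= /val_ge oner_eq0 lval1.
- move=> a x y; rewrite !inE rmorphD rmorphM => hx hy; apply: lvalD => //.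
  by rewrite -[Posz _]add0r; apply: val_geM => //; case: (a).
Qed.
HB.instance Definition _ s := isIdealr.Build intring (pideal s)
  (pideal_idealr s).

(* The ring O_s = O / p^s, for s >= 1. As with 'Z_p, the exponent s.-1.+1     *)
(* makes the quotient a nontrivial ring for every s : nat.                    *)
Definition resring (s : nat) := {ideal_quot (pideal s)}.

HB.instance Definition _ s := GRing.ComNzRing.on (resring s).

Definition redO (s : nat) : intring -> resring s := \pi_(resring s).
HB.instance Definition _ s := GRing.RMorphism.on (redO s).

Definition liftO (s : nat) : resring s -> intring :=
  @generic_quotient.repr _ (resring s).

Lemma liftOK s : cancel (@liftO s) (@redO s).
Proof. exact: reprK. Qed.

Lemma redO_eq s (x y : intring) :
  (redO s x == redO s y) = val_ge v s.-1.+1 (val x - val y).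
Proof. by rewrite /redO -Quotient.idealrBE. Qed.

(* Finiteness of O_s, by iterating digit expansion along lreps. *)
Definition uniformizer : F := xchoose (lval_surj K).

Lemma lval_uniformizerX n : v (uniformizer ^+ n) = n.
Proof.
have /andP[t0 /eqP vt] := xchooseP (lval_surj K).
elim: n => [|n IHn]; first by rewrite expr0 lval1.
by rewrite exprS lvalM ?expf_neq0 // vt IHn.
Qed.

Fixpoint resreps (n : nat) : seq F :=
  if n is m.+1 then [seq y + uniformizer ^+ m * c | y <- resreps m, c <- lreps K]
  else [:: 0].

Lemma resrepsP n x : val_ge v 0 x ->
  exists2 y, y \in resreps n & val_ge v 0 y && val_ge v n (x - y).
Proof.
move=> hx; elim: n => [|n [y yr /andP[hy hxy]]].
  by exists 0; rewrite ?inE // subr0 hx /val_ge eqxx.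
set t := uniformizer ^+ n.
have t0 : t != 0.
  by rewrite expf_neq0 //; case/andP: (xchooseP (lval_surj K)).
pose z := (x - y) / t.
have hz : val_ge v 0 z.
  rewrite /val_ge mulf_eq0 invr_eq0 (negPf t0) orbF.
  case: (eqVneq (x - y) 0) => //= xy0.
  have z0 : z != 0 by rewrite mulf_neq0 ?invr_eq0.
  have: v (z * t) = v z + n by rewrite lvalM ?lval_uniformizerX.
  rewrite divfK // => e; move: hxy; rewrite /val_ge (negPf xy0) /= e.
  by rewrite -{1}[Posz n]add0r lerD2r.
have [c cr /andP[hc hzc]] := lrepsP hz.
exists (y + t * c); first exact: allpairs_f.
have ht : val_ge v n t by rewrite /val_ge lval_uniformizerX lexx orbT.
apply/andP; split.
  apply: lvalD => //; apply: (@val_geW _ (n%:Z + 0)); first by rewrite addr0.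
  exact: val_geM.
have -> : x - (y + t * c) = t * (z - c).
  by rewrite mulrBr [t * z]mulrC divfK // opprD addrA.
by rewrite -addn1 PoszD; apply: val_geM.
Qed.

Definition resring_enum (s : nat) : seq (resring s) :=
  undup [seq redO s (insubd 0 y) | y <- resreps s.-1.+1].

Lemma mem_resring_enum s q : q \in resring_enum s.
Proof.
rewrite mem_undup -(liftOK q).
have [y yr /andP[hy hxy]] := resrepsP s.-1.+1 (valP (liftO q)).
apply/mapP; exists y => //; apply/eqP.
by rewrite redO_eq /= /insubd insubT.
Qed.

Lemma resring_indexK s :
  cancel (fun q => index q (resring_enum s)) (nth 0 (resring_enum s)).
Proof. by move=> q; rewrite nth_index ?mem_resring_enum. Qed.

HB.instance Definition _ s :=
  Countable.copy (resring s) (can_type (@resring_indexK s)).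

Lemma resring_enumP s : Finite.axiom (resring_enum s).
Proof. by move=> q; rewrite count_uniq_mem ?undup_uniq ?mem_resring_enum. Qed.

HB.instance Definition _ s := isFinite.Build (resring s) (@resring_enumP s).
HB.instance Definition _ s := FinRing.isNzRing.Build (resring s).
HB.instance Definition _ s := FinRing.ComUnitRing.on (resring s).

(* A generator of the maximal ideal. *)
Record idgen := IdGen {
  genval :> intring;
  genvalP : (intval genval != 0) && (v genval == 1)
}.

(* An additive character of F, trivial on O but not on p^-1. Such a psi takes *)
(* root-of-unity values, so algC can replace the complex numbers.             *)
Definition additive_char (psi : F -> algC) : Prop :=
  [/\ forall x y, psi (x + y) = psi x * psi y,
      forall x, val_ge v 0 x -> psi x = 1
    & exists2 x, val_ge v (-1) x & psi x != 1].

End ValuationRing.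

Section CongruenceCharacters.
Variables (F : fieldType) (K : localField F) (pi : idgen K) (N : nat).

(* The congruence subgroup K^l = I + p^l M_N(O_r) of GL_N(O_r). *)
Definition congrGL (r l : nat) : {set {'GL_N[resring K r]}} :=
  [set g | [exists x : 'M_(N.-1.+1), GLval g == 1 + redO r pi ^+ l *: x]].

Lemma congrGLP r l (g : {'GL_N[resring K r]}) :
  reflect (exists x : 'M_(N.-1.+1), GLval g = 1 + redO r pi ^+ l *: x)
          (g \in congrGL r l).
Proof.
by rewrite inE; apply: (iffP existsP) => -[x] => [/eqP|] gE; exists x => //;
   apply/eqP.
Qed.

Lemma congrGL_group_set r l : group_set (congrGL r l).
Proof.
apply/group_setP; split=> [|g h].
  by apply/congrGLP; exists 0; rewrite scaler0 addr0.
case/congrGLP=> x gE /congrGLP[y hE]; apply/congrGLP.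
exists (x + y + redO r pi ^+ l *: (x * y)).
rewrite GL_ME gE hE mulrDl mul1r mulrDr mulr1 -!addrA; congr (_ + _).
by rewrite -scalerAl -scalerAr !scalerDr addrCA !addrA.
Qed.

Canonical congrGL_group r l := Group (congrGL_group_set r l).

Lemma lval_idgenX n : lval K (val (pi : intring K) ^+ n) = n.
Proof.
have /andP[p0 /eqP vp] := genvalP pi.
elim: n => [|n IHn]; first by rewrite expr0 lval1.
by rewrite exprS lvalM ?expf_neq0 // vp IHn.
Qed.

Lemma redO_idgenX r n : (0 < r)%N -> (redO r pi ^+ n == 0) = (r <= n)%N.
Proof.
have /andP[p0 _] := genvalP pi => r0.
rewrite -rmorphXn -(rmorph0 (redO r)) redO_eq subr0 rmorphXn /=.
by rewrite /val_ge lval_idgenX expf_eq0 (negPf p0) andbF prednK.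
Qed.

Section EvenLevel.
Variables (psi : F -> algC) (l : nat).
Local Notation r := (2 * l)%N.

Definition liftF s n (A : 'M[resring K s]_n) : 'M[F]_n :=
  map_mx (fun a => val (liftO a)) A.

(* The function I + pi^l x |-> psi (pi^-l tr (M x)); psi_charE below shows    *)
(* that it does not depend on the choice of x nor on the lifts of M and x.    *)
Definition psi_fun (M : 'M[resring K l]_(N.-1.+1)) (g : {'GL_N[resring K r]})
    : algC :=
  if [pick x : 'M_(N.-1.+1) | GLval g == 1 + redO r pi ^+ l *: x] is Some x
  then psi (val (pi : intring K) ^- l * \tr (liftF M *m liftF x))
  else 0.

Hypothesis l_gt0 : (0 < l)%N.

Lemma congrGL_abelian : abelian (congrGL r l).
Proof.
apply/centsP=> g /congrGLP[x gE] h /congrGLP[y hE]; rewrite /commute.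
suff e : GLval (g * h)%g = GLval (h * g)%g by exact: val_inj e.
have pp : redO r pi ^+ l * redO r pi ^+ l = 0.
  by apply/eqP; rewrite -exprD redO_idgenX ?muln_gt0 // mul2n addnn.
rewrite !GL_ME gE hE !(mulrDl, mulrDr) !mul1r !mulr1.
rewrite -!scalerAl -!scalerAr !scalerA pp !scale0r !addr0 -!addrA.
by congr (_ + _); rewrite addrC.
Qed.

Fact psi_char_subproof M : is_class_fun <<congrGL_group r l>>%g (finfun (psi_fun M)).
Proof.
rewrite genGid; apply: intro_class_fun => [g h gK hK|g gK].
  by rewrite conjgE (centsP congrGL_abelian _ gK _ hK) mulKg.
rewrite /psi_fun; case: pickP => // x /eqP gE.
by case/congrGLP: gK; exists x.
Qed.

Definition psi_char M : 'CF(congrGL_group r l) := Cfun 0 (psi_char_subproof M).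

Lemma psi_charE (M x : 'M[intring K]_(N.-1.+1)) (g : {'GL_N[resring K r]}) :
    additive_char K psi ->
    GLval g = 1 + redO r pi ^+ l *: map_mx (redO r) x ->
  psi_char (map_mx (redO l) M) g =
    psi (val (pi : intring K) ^- l * \tr (map_mx val M *m map_mx val x)).
Proof.
case=> psiD psi1 _ gE; rewrite cfunE /psi_fun.
case: pickP => [y|/(_ (map_mx (redO r) x))]; last by rewrite gE eqxx.
rewrite gE => /eqP/addrI exy.
set a := psi _; set b := (X in psi X); rewrite {}/a.
set a := (X in psi X).
suff hab : val_ge (lval K) 0 (a - b).
  by rewrite -[a](subrK b) psiD psi1 ?mul1r.
have /andP[p0 _] := genvalP pi.
have r_gt0 : (0 < r)%N by rewrite muln_gt0.
have hM i j : val_ge (lval K) l (val (liftO (redO l (M i j))) - val (M i j)).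
  by rewrite -{1}(prednK l_gt0) -redO_eq liftOK.
have r2 : r%:Z = l%:Z + l%:Z by rewrite mul2n -addnn PoszD.
have hx i j : val_ge (lval K) l (val (liftO (y i j)) - val (x i j)).
  have /matrixP/(_ i j) := exy; rewrite !mxE -[y i j]liftOK -!rmorphXn -!rmorphM.
  move/esym/eqP; rewrite redO_eq prednK // !rmorphM !rmorphXn /= -mulrBr.
  set d := (_ - _); rewrite liftOK /val_ge mulf_eq0 expf_eq0 (negPf p0) andbF /=.
  case: (eqVneq d 0) => //= d0.
  by rewrite lvalM ?expf_neq0 // lval_idgenX [leLHS]r2 lerD2l.
have sumP I (P : seq I) f : (forall i, val_ge (lval K) l (f i)) ->
    val_ge (lval K) l (\sum_(i <- P) f i).
  move=> hf; elim/big_ind: _ => // [|u v hu hv]; last exact: lvalD.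
  by rewrite /val_ge eqxx.
rewrite /a /b -mulrBr; set D := _ - _.
have dsub (m' y' m x' : F) : m' * y' - m * x' = (m' - m) * y' + m * (y' - x').
  by rewrite mulrBl mulrBr addrA subrK.
have hD : val_ge (lval K) l D.
  rewrite /D /mxtrace -sumrB; apply: (sumP) => i; rewrite !mxE -sumrB;
  apply: (sumP) => j; rewrite !mxE.
  rewrite dsub; apply: lvalD.
    by rewrite -[Posz l]addr0; apply: val_geM (hM i j) (valP (liftO (y j i))).
  by rewrite -[Posz l]add0r; apply: val_geM (valP (M i j)) (hx j i).
rewrite /val_ge mulf_eq0 invr_eq0 expf_eq0 (negPf p0) andbF /=.
case: (eqVneq D 0) => //= D0.
have ep : (val (pi : intring K) ^+ l) != 0 by rewrite expf_neq0.
set z := _ * D; have z0 : z != 0 by rewrite mulf_neq0 ?invr_eq0.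
have := lvalM K ep z0; rewrite mulrA divff // mul1r lval_idgenX => e.
by move: hD; rewrite /val_ge (negPf D0) /= e lerDl.
Qed.

End EvenLevel.
End CongruenceCharacters.

(* A finite unramified extension of F: the normalized valuation of the        *)
(* extension restricts to that of F (ramification index 1); the residue       *)
(* extension is one of finite fields, hence separable.                        *)
Record unramifiedExt (F : fieldType) (K : localField F) := UnramifiedExt {
  ue_field :> fieldExtType F;
  ue_local : localField ue_field;
  ue_val : forall x : F, x != 0 -> lval ue_local x%:A = lval K x
}.

Section BaseChange.
Variables (F : fieldType) (K : localField F) (E : unramifiedExt K).

Fact extO_subproof (x : intring K) :
  (val x)%:A \in (integral (ue_local E) : {pred ue_field E}).
Proof.
have := valP x; rewrite !inE /val_ge /= scaler_eq0 oner_eq0 orbF.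
by case: eqVneq => //= x0; rewrite ue_val.
Qed.

(* The inclusions of O into the ring of integers of E, and of O_s into its    *)
(* counterpart for E.                                                         *)
Definition extO (x : intring K) : intring (ue_local E) :=
  IntRing (extO_subproof x).

Definition ext_res s (a : resring K s) : resring (ue_local E) s :=
  redO s (extO (liftO a)).
End BaseChange.

Section Jordan.
Variable R : nzRingType.

Definition Jordan_block n (lam : R) : 'M[R]_n :=
  \matrix_(i, j) (if i == j then lam else (j == i.+1 :> nat)%:R).

Definition Jordan_form n (A : 'M[R]_n) : Prop :=
  exists (k : nat) (d : 'I_k -> nat) (lam : 'I_k -> R)
         (e : (\sum_(i < k) d i)%N = n),
    (forall i, 0 < d i)%N /\
    A = castmx (e, e) (\mxdiag_(i < k) Jordan_block (d i) (lam i)).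

Definition in_center_centralizer n (A B : 'M[R]_n) : Prop :=
  comm_mx B A /\ (forall X, comm_mx X A -> comm_mx B X).
End Jordan.

Section Stable.
Variables (F : fieldType) (K : localField F).

(* The residue field k is resring K 1. *)
Definition mult_section (mu : resring K 1 -> intring K) : Prop :=
  {morph mu : a b / a * b} /\ cancel mu (redO 1).

(* The composite O_s -> k -> O -> O_s of reduction, mu and reduction. *)
Definition teich (mu : resring K 1 -> intring K) s (a : resring K s) :
    resring K s :=
  redO s (mu (redO 1 (liftO a))).
End Stable.

Definition stable_mx (F : fieldType) (K : localField F) (pi : idgen K)
    (s n : nat) (M : 'M[resring K s]_n) : Prop :=
  exists (E : unramifiedExt K)
         (mu : resring (ue_local E) 1 -> intring (ue_local E))
         (P A B : 'M[resring (ue_local E) s]_n),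
    [/\ mult_section mu,
        P \in unitmx
          /\ P *m map_mx (ext_res E (s := s)) M *m invmx P
               = A + redO s (extO E pi) *: B,
        Jordan_form A,
        A = map_mx (teich mu (s := s)) A
      & in_center_centralizer A B].

Section StableCharacters.
Variables (F : fieldType) (K : localField F) (pi : idgen K).
Variables (psi : F -> algC) (N l : nat) (l_gt0 : (0 < l)%N).
Local Notation r := (2 * l)%N.

Definition above (chi : 'CF('GL_N[resring K r])) (M : 'M[resring K l]_(N.-1.+1))
    : Prop :=
  '['Res[congrGL_group pi N r l] chi, psi_char pi psi l_gt0 M] != 0.

Definition stable_char (chi : 'CF('GL_N[resring K r])) : Prop :=
  exists M : 'M[resring K l]_(N.-1.+1), stable_mx pi M /\ above chi M.
End StableCharacters.

(* Main.v *)
(* Over an unramified extension the stable matrix M becomes A + pi B, with A  *)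
(* a Jordan matrix whose distinct eigenvalues differ by units, and B central  *)
(* in the centralizer C(A). By Clifford theory and Gallagher's theorem it is  *)
(* enough to extend psi_M to its stabilizer T, i.e., to show that psi_M is    *)
(* trivial on the intersection of K^l with the derived subgroup of T. The     *)
(* elements of T commute with M, hence with A, modulo p^l, and C(A) is a      *)
(* direct summand of the matrix ring, cut out by an explicit projection. This *)
(* yields two kinds of morphisms from T to abelian groups: for each           *)
(* eigenvalue, the determinant of the corresponding diagonal part, which maps *)
(* 1 + pi^l x to 1 + pi^l times the trace of that part of x, and a cocycle    *)
(* for the nilpotent part of M, which pairs to zero with C(A). Together they  *)
(* determine tr(M x) modulo p^l on 1 + pi^l x, so tr(M x) = 0 modulo p^l on   *)
(* the derived subgroup. Only T is mapped to the extension: neither an        *)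
(* extension of psi nor a descent of the Jordan form is needed.               *)

Require Import Defs.
From HB Require Import structures.
From mathcomp Require Import all_boot all_order all_algebra all_fingroup.
From mathcomp Require Import all_solvable all_field all_character.
From mathcomp Require Import zify ring.

Set Implicit Arguments.
Unset Strict Implicit.
Unset Printing Implicit Defensive.

Import Order.TTheory GRing.Theory Num.Theory.
Local Open Scope ring_scope.

(** Write [t = p ^+ l], so that [t * t = 0] in [O_r]. Clifford theory and Gallagher's theorem
    ([irr_above_extendible]) give both claims as soon as the linear character [psiM] is trivial on
    the elements of [Kl] that lie in the derived subgroup of its stabilizer. Nondegeneracy of [psi]
    turns fixing [psiM] into commuting with M modulo t ([inertia_comm_mult]), so for a stable M the
    claim becomes: t tr(M x) = 0 whenever 1 + t x lies in that derived subgroup ([stable_der1_tr]).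

    After base change and conjugation, M is A + pB modulo t. Matrices commuting with A modulo t are
    congruent to matrices truly commuting with A ([sub_Jordan_proj]); hence commuting with M modulo
    t implies commuting with A modulo t ([stable_centralizer]). As M is central there, it is the sum
    of a diagonal matrix, constant modulo t on each eigenvalue of A, and of a part whose trace
    pairing with that centralizer vanishes modulo t. The first part is seen by the determinants
    [eigendet], the second by the additive map [nilcocycle]. Both are morphisms to abelian groups
    because t squares to zero, so they are trivial on commutators, and [der1_tr0] combines them. *)

(** * Extension of linear characters and Clifford theory *)

Section LinearCharacterExtension.
Local Open Scope group_scope.
Local Open Scope ring_scope.
Variable gT : finGroupType.
Implicit Types G H K T : {group gT}.

Lemma morph_lin_char G (phi : 'CF(G)) :
    phi 1%g = 1 -> {in G &, {morph phi : x y / (x * y)%g >-> x * y}} ->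
  phi \is a linear_char.
Proof.
move=> phi1 phiM; rewrite qualifE /= phi1 eqxx andbT.
have rP: mx_repr G (fun x => (phi x)%:M : 'M[algC]_1).
  split=> [|x y Gx Gy]; first by rewrite phi1.
  by rewrite phiM // scalar_mxM.
apply/char_reprP; exists (Representation (MxRepresentation rP)).
by apply/cfun_inP=> x Gx; rewrite cfunE Gx mulr1n /= mxtrace_scalar.
Qed.

(* The regular character of T / T', inflated to T, is |T : T'| times the      *)
(* indicator of T'; its scalar product on K with phi is therefore positive,   *)
(* so phi occurs in the restriction of some linear character of T.            *)
Lemma lin_char_extend K T (phi : 'CF(K)) :
    K \subset T -> phi \is a linear_char ->
    {in K :&: T^`(1)%g, forall x, phi x = 1} ->
  exists2 xi : 'CF(T), xi \is a linear_char & 'Res[K] xi = phi.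
Proof.
move=> sKT phi_lin phi_der1.
pose rho := (cfReg (T / T^`(1)%g) %% T^`(1)%g)%CF.
have nsT' : T^`(1)%g <| T := der_normal 1 T.
have rho_val x : x \in K -> rho x = #|T / T^`(1)%g|%g%:R *+ (x \in T^`(1)%g).
  move=> Kx; have Tx := subsetP sKT x Kx.
  rewrite cfModE // cfRegE; congr (_ *+ nat_of_bool _).
  apply/eqP/idP; last exact: coset_id.
  by apply: coset_idr; apply: (subsetP (normal_norm nsT')).
have rho_phi : '['Res[K] rho, phi] != 0.
  rewrite cfdotE mulf_neq0 ?invr_eq0 ?neq0CG //.
  rewrite (bigID (mem T^`(1)%g)) /= [X in _ + X]big1 => [|x /andP[Kx /negPf T'x]].
    rewrite addr0 (eq_bigr (fun=> #|T / T^`(1)%g|%g%:R)) => [|x /andP[Kx T'x]].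
      rewrite sumr_const -mulrnA pnatr_eq0 -lt0n muln_gt0 cardG_gt0 /=.
      by apply/card_gt0P; exists 1%g; rewrite unfold_in /= !group1.
    rewrite cfResE // rho_val // T'x mulr1n phi_der1 ?inE ?Kx //.
    by rewrite rmorph1 mulr1.
  by rewrite cfResE // rho_val // T'x mul0r.
suff [i phi_i]: exists i : Iirr (T / T^`(1)%g),
    '['Res[K] ('chi_i %% T^`(1)%g)%CF, phi] != 0.
  have chi_lin : 'chi_i \is a linear_char.
    by apply/char_abelianP; apply: der_abelian.
  exists ('chi_i %% T^`(1)%g)%CF; first exact: cfMod_lin_char.
  have /irrP[j Dj] := lin_char_irr (cfRes_lin_char K (cfMod_lin_char chi_lin)).
  have /irrP[k Dk] := lin_char_irr phi_lin.
  by move: phi_i; rewrite Dj Dk cfdot_irr pnatr_eq0 eqb0 negbK => /eqP->.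
apply/existsP; apply: contraNT rho_phi => /existsPn nphi.
rewrite /rho cfReg_sum !linear_sum cfdot_suml big1 // => i _.
by rewrite !linearZ cfdotZl; move/negbNE/eqP: (nphi i) => ->; rewrite mulr0.
Qed.

(** The stability of a character may come from another matrix than M; this carries the extension
    criterion from one of the two conjugate characters to the other. *)
Lemma der1_inertia_conj K G (phi phi' : 'CF(K)) :
    K <| G -> (phi' \in phi ^: G)%CF ->
    {in K :&: ('I_G[phi])^`(1)%g, forall x, phi x = 1} ->
  {in K :&: ('I_G[phi'])^`(1)%g, forall x, phi' x = 1}.
Proof.
move=> nsKG /cfclassP[y Gy ->] phi_der1 x /setIP[Kx].
have nKy : y \in 'N(K) by apply: (subsetP (normal_norm nsKG)).
have <- : ('I_G[phi] :^ y)%g = 'I_G[(phi ^ y)%CF].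
  by rewrite conjIg conjGid // conjg_inertia.
rewrite derJ mem_conjg => Tx; rewrite cfConjgE //; apply: phi_der1.
by rewrite inE Tx memJ_norm ?groupV ?Kx.
Qed.

(** By Clifford's theorem the restriction is a multiple of the sum over a single orbit. *)
Lemma irr_above_conj K G (chi : 'CF(G)) (phi phi' : 'CF(K)) :
    K <| G -> chi \in irr G -> phi \in irr K -> phi' \in irr K ->
    '['Res[K] chi, phi] != 0 -> '['Res[K] chi, phi'] != 0 ->
  (phi' \in phi ^: G)%CF.
Proof.
move=> nsKG /irrP[i ->] /irrP[j ->] /irrP[k ->] chi_j.
rewrite (Clifford_Res_sum_cfclass nsKG (j := j)) //.
rewrite cfdotZl mulf_eq0 negb_or => /andP[_]; apply: contraR => jGk.
rewrite cfdot_suml big_seq big1 // => xi /cfclassP[y Gy def_xi].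
have [m Dm] : exists m, xi = 'chi_m.
  by exists (conjg_Iirr j y); rewrite conjg_IirrE.
rewrite Dm cfdot_irr; case: (m =P k) => // def_k; case/negP: jGk.
by apply/cfclassP; exists y; rewrite // -def_xi Dm def_k.
Qed.

Lemma irr_above_extendible K G (chi : 'CF(G)) (phi : 'CF(K)) :
    K <| G -> chi \in irr G -> phi \is a linear_char ->
    '['Res[K] chi, phi] != 0 ->
    {in K :&: ('I_G[phi])^`(1)%g, forall x, phi x = 1} ->
  let T := 'I_G[phi]%G in
  exists xi : 'CF(T),
    [/\ xi \is a character, 'Res[K] xi = phi
      & exists2 rho : 'CF(T / K),
          rho \in irr (T / K) & chi = 'Ind[G] (xi * (rho %% K)%CF)].
Proof.
move=> nsKG /irrP[i ->] phi_lin chi_phi phi_der1 T.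
have nsKT : K <| T := normal_Inertia phi (normal_sub nsKG).
have [xi xi_lin xi_phi] := lin_char_extend (normal_sub nsKT) phi_lin phi_der1.
exists xi; split; rewrite // ?lin_charW //.
have /irrP[c Dc] := lin_char_irr xi_lin.
have /irrP[t Dt] := lin_char_irr phi_lin.
rewrite {}Dt in chi_phi @T nsKT xi xi_lin xi_phi c Dc *.
have chi_calB : i \in irr_constt ('Ind[G] 'chi_t).
  by rewrite constt_Ind_Res irr_consttE.
(* Clifford correspondence: [chi] is induced from a constituent [s] of the character of T induced by
   [phi]. By Gallagher's theorem [s] is [xi] times a character inflated from [T / K]. *)
have [IndP _ AB _ _] := constt_Inertia_bijection t nsKG.
move: chi_calB; rewrite -AB => /imsetP[s sA Di].
have [irrM _ constt_s _] := constt_Ind_ext nsKT (etrans (congr1 _ (esym Dc)) xi_phi).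
move: (sA); rewrite constt_s => /codomP[b Ds].
exists 'chi_b; first exact: mem_irr.
have /irrP[k Dk] := IndP _ sA.
rewrite Di /Ind_Iirr Dk irrK -Dk Ds Dc -mod_IirrE //.
by rewrite /mul_mod_Iirr /mul_Iirr cfIirrE ?irrM // mulrC.
Qed.

End LinearCharacterExtension.

(** * Congruences modulo a principal ideal *)

Lemma subr_mxE (V : zmodType) m n (X Y : 'M[V]_(m, n)) i j :
  (X - Y) i j = X i j - Y i j.
Proof. by rewrite !mxE. Qed.

Section Multiples.
Variables (R : finComUnitRingType) (t : R).

(** Boolean, thanks to the finiteness of R, so that the [rpred] lemmas apply to the ideal generated
    by t. *)
Definition multiples : {pred R} := [pred x | [exists y, x == t * y]].

Lemma multiplesP x : reflect (exists y, x = t * y) (x \in multiples).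
Proof.
by rewrite inE; apply: (iffP existsP) => -[y] => [/eqP|] ->; exists y.
Qed.

Fact multiples_zmod_closed : zmod_closed multiples.
Proof.
split=> [|x y /multiplesP[a ->] /multiplesP[b ->]]; apply/multiplesP.
  by exists 0; rewrite mulr0.
by exists (a - b); rewrite mulrBr.
Qed.
HB.instance Definition _ :=
  GRing.isZmodClosed.Build R multiples multiples_zmod_closed.

Lemma multiplesMl a x : x \in multiples -> a * x \in multiples.
Proof.
by case/multiplesP=> y ->; apply/multiplesP; exists (a * y); rewrite mulrCA.
Qed.

Lemma multiplesMr a x : x \in multiples -> x * a \in multiples.
Proof. by rewrite mulrC; apply: multiplesMl. Qed.

Lemma mem_multiples a : t * a \in multiples.
Proof. by apply/multiplesP; exists a. Qed.

Lemma multiplesMu u x : u \is a GRing.unit ->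
  (x * u \in multiples) = (x \in multiples).
Proof.
move=> Uu; apply/idP/idP => [|/multiplesMr->//].
by move/(multiplesMr u^-1); rewrite mulrK.
Qed.

Lemma multiples_cancel x y z :
  x + y - z \in multiples -> y \in multiples -> z \in multiples ->
  x \in multiples.
Proof.
by move=> txyz ty tz; rewrite -[x](addrK (y - z)) rpredB ?addrA // rpredB.
Qed.

Definition mxmult m n (X : 'M[R]_(m, n)) : Prop :=
  forall i j, X i j \in multiples.

Lemma mxmultP m n (X : 'M[R]_(m, n)) :
  mxmult X <-> exists Y, X = t *: Y.
Proof.
split=> [tX|[Y ->] i j]; last by rewrite mxE mem_multiples.
have exY i j : exists y, X i j == t * y by have /existsP := tX i j.
exists (\matrix_(i, j) xchoose (exY i j)); apply/matrixP=> i j.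
by rewrite !mxE; apply/eqP/(xchooseP (exY i j)).
Qed.

Section Ops.
Variables (m n p : nat).
Implicit Types X Y : 'M[R]_(m, n).

Lemma mxmultZ X : mxmult (t *: X).
Proof. by move=> i j; rewrite mxE mem_multiples. Qed.

Lemma mxmult0 : mxmult (0 : 'M[R]_(m, n)).
Proof. by move=> i j; rewrite mxE rpred0. Qed.

Lemma mxmultD X Y : mxmult X -> mxmult Y -> mxmult (X + Y).
Proof. by move=> tX tY i j; rewrite mxE rpredD. Qed.

Lemma mxmultN X : mxmult X -> mxmult (- X).
Proof. by move=> tX i j; rewrite mxE rpredN. Qed.

Lemma mxmultB X Y : mxmult X -> mxmult Y -> mxmult (X - Y).
Proof. by move=> tX tY; apply: mxmultD => //; apply: mxmultN. Qed.

Lemma mxmultMl X (Z : 'M[R]_(p, m)) : mxmult X -> mxmult (Z *m X).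
Proof. by move=> tX i j; rewrite mxE rpred_sum // => h _; apply: multiplesMl. Qed.

Lemma mxmultMr X (Z : 'M[R]_(n, p)) : mxmult X -> mxmult (X *m Z).
Proof. by move=> tX i j; rewrite mxE rpred_sum // => h _; apply: multiplesMr. Qed.

End Ops.
End Multiples.

(** * Determinants near 1 and multiplicative maps on derived subgroups *)

Lemma det_addr_sqr0 (R : comNzRingType) n (t : R) (X : 'M[R]_n) :
  t * t = 0 -> \det (1%:M + t *: X) = 1 + t * \tr X.
Proof.
move=> tt; rewrite /determinant (bigD1 1%g) //= [X in _ + X]big1 => [|s ns].
  rewrite addr0 odd_perm1 mul1r /mxtrace.
  under eq_bigr => i _ do rewrite perm1 !mxE eqxx.
  elim/big_rec2: _ => [|i y x _ ->]; first by rewrite mulr0 addr0.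
  rewrite (_ : (_ + _) * _ = 1 + t * (X i i + y) + t * t * (X i i * y)).
    by rewrite tt mul0r addr0.
  by rewrite mulr1n; ring.
(* A permutation moving i also moves [s i]; its product then has two off-diagonal factors, both
   multiples of t. *)
have [i nsi] : exists i, s i != i.
  apply/existsP; apply: contraR ns => /existsPn si; apply/eqP/permP => i.
  by rewrite perm1; apply/eqP/negbNE.
have nssi : s (s i) != s i by rewrite (inj_eq perm_inj).
rewrite (bigD1 i) //= (bigD1 (s i)) //= !mxE.
rewrite [i == _]eq_sym [s i == s (s i)]eq_sym (negPf nsi) (negPf nssi) !add0r.
by rewrite [_ * (_ * \prod_(_ | _) _)]mulrA [t * _ * _]mulrACA tt !mul0r mulr0.
Qed.

Lemma multiplicative_der1 (gT : finGroupType) (T : {group gT})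
    (S : comNzRingType) (h : gT -> S) :
    h 1%g = 1 -> {in T &, {morph h : x y / (x * y)%g >-> x * y}} ->
  {in T^`(1)%g, forall x, h x = 1}.
Proof.
move=> h1 hM.
have kerP : group_set [set x in T | h x == 1].
  apply/group_setP; split=> [|x y]; first by rewrite inE group1 h1 eqxx.
  rewrite !inE => /andP[Tx /eqP hx] /andP[Ty /eqP hy].
  by rewrite groupM // hM // hx hy mulr1 eqxx.
suff /subsetP sT'K : (T^`(1) \subset Group kerP)%g.
  by move=> x /sT'K; rewrite inE => /andP[_ /eqP].
rewrite gen_subG; apply/subsetP=> _ /imset2P[x y Tx Ty ->].
rewrite inE groupR // commgEl conjgE !hM ?(groupM, groupV) //.
rewrite mulrCA [h x^-1%g * _]mulrA -[h x^-1%g * _]hM ?groupV // mulVg h1 mul1r.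
by rewrite -hM ?groupV // mulVg h1 eqxx.
Qed.

(** * The centralizer of a Jordan matrix, exactly and modulo t *)

Section JordanCentralizer.
Variables (R : finComUnitRingType) (n' k : nat).
Local Notation n := n'.+1.
Variables (blk : 'I_n -> 'I_k) (pos : 'I_n -> nat).
Variables (d : 'I_k -> nat) (ix : 'I_k -> nat -> 'I_n).
Hypothesis pos_lt : forall i, (pos i < d (blk i))%N.
Hypothesis ixK : forall i, ix (blk i) (pos i) = i.
Hypothesis blk_ix : forall c q, (q < d c)%N -> blk (ix c q) = c.
Hypothesis pos_ix : forall c q, (q < d c)%N -> pos (ix c q) = q.

Variable lam : 'I_k -> R.
Hypothesis lam_unit :
  forall c c', lam c != lam c' -> lam c' - lam c \is a GRing.unit.

(** Indices are pairs of a block and a position in it, with inverse map [ix]; this replaces the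
    casts of [\mxdiag] by arithmetic on positions. *)
Definition Jordan_of : 'M[R]_n := \matrix_(i, j)
  if blk i == blk j
  then if pos i == pos j then lam (blk i) else (pos j == (pos i).+1)%:R
  else 0.
Local Notation A := Jordan_of.

Lemma eq_ix i j : (i == j) = (blk i == blk j) && (pos i == pos j).
Proof.
apply/eqP/andP=> [->//|[/eqP eb /eqP ep]].
by rewrite -(ixK i) -(ixK j) eb ep.
Qed.

Lemma Jordan_ofE i j :
  A i j = lam (blk i) *+ (i == j)
          + ((blk i == blk j) && (pos j == (pos i).+1))%:R.
Proof.
rewrite mxE eq_ix; case: eqP => //= _; last by rewrite addr0.
by case: eqP => [->|_]; rewrite ?add0r // mulr1n ltn_eqF ?addr0.
Qed.

(** The nilpotent part of A shifts columns on the right and rows on the left; the conditionals are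
    the block borders. The centralizer is computed from this recurrence. *)
Lemma commutator_entry (X : 'M[R]_n) c c' p q : (p < d c)%N -> (q < d c')%N ->
  (X * A - A * X) (ix c p) (ix c' q) =
    X (ix c p) (ix c' q) * (lam c' - lam c)
    + (if (0 < q)%N then X (ix c p) (ix c' q.-1) else 0)
    - (if (p.+1 < d c)%N then X (ix c p.+1) (ix c' q) else 0).
Proof.
move=> pd qd; rewrite subr_mxE 2!mxE.
have -> : \sum_j X (ix c p) j * A j (ix c' q) = X (ix c p) (ix c' q) * lam c'
    + (if (0 < q)%N then X (ix c p) (ix c' q.-1) else 0).
  under eq_bigr => j _ do rewrite Jordan_ofE mulrDr.
  rewrite big_split /=; congr (_ + _).
    rewrite (bigD1 (ix c' q)) //= eqxx mulr1n blk_ix // big1 ?addr0 //.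
    by move=> j /negPf->; rewrite mulr0n mulr0.
  case: (posnP q) => [q0|q0].
    by rewrite big1 // => j _; rewrite pos_ix // q0 andbF mulr0.
  rewrite (bigD1 (ix c' q.-1)) //= !blk_ix ?pos_ix //; try lia.
  rewrite prednK // !eqxx mulr1 big1 ?addr0 // => j.
  rewrite eq_ix blk_ix ?pos_ix //; try lia.
  move=> nj; suff -> : (blk j == c') && (q == (pos j).+1) = false.
    by rewrite mulr0.
  by apply: contraNF nj => /andP[-> /eqP->] /=.
have -> : \sum_j A (ix c p) j * X j (ix c' q) = lam c * X (ix c p) (ix c' q)
    + (if (p.+1 < d c)%N then X (ix c p.+1) (ix c' q) else 0).
  under eq_bigr => j _ do rewrite Jordan_ofE mulrDl.
  rewrite big_split /=; congr (_ + _).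
    rewrite (bigD1 (ix c p)) //= eqxx mulr1n blk_ix // big1 ?addr0 //.
    by move=> j nj; rewrite eq_sym (negPf nj) mulr0n mul0r.
  case: ltnP => pd'.
    rewrite (bigD1 (ix c p.+1)) //= !blk_ix ?pos_ix // !eqxx mul1r.
    rewrite big1 ?addr0 // => j; rewrite eq_ix blk_ix ?pos_ix //.
    by rewrite eq_sym => /negPf->; rewrite mul0r.
  rewrite big1 // => j _; rewrite blk_ix ?pos_ix //.
  case: eqP => [ec|]; rewrite ?mul0r //=; have := pos_lt j; rewrite -ec.
  by case: eqP => [->|]; rewrite ?mul0r //; lia.
by ring.
Qed.

(** The centralizer of A consists of upper triangular Toeplitz blocks between equal eigenvalues,
    with offset at least the excess of column size over row size. [Phi] keeps the first row of each
    block and propagates it along the diagonals. *)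
Definition Jordan_proj (Y : 'M[R]_n) : 'M[R]_n := \matrix_(i, j)
  if [&& lam (blk i) == lam (blk j), pos i <= pos j
       & d (blk j) + pos i <= d (blk i) + pos j]%N
  then Y (ix (blk i) 0) (ix (blk j) (pos j - pos i)) else 0.
Local Notation Phi := Jordan_proj.

Lemma matrix_ixP (X Y : 'M[R]_n) :
    (forall c c' p q, (p < d c)%N -> (q < d c')%N ->
       X (ix c p) (ix c' q) = Y (ix c p) (ix c' q)) -> X = Y.
Proof.
by move=> eXY; apply/matrixP=> i j; rewrite -(ixK i) -(ixK j) eXY.
Qed.

Lemma Jordan_projE Y c c' p q : (p < d c)%N -> (q < d c')%N ->
  Phi Y (ix c p) (ix c' q) =
    if [&& lam c == lam c', p <= q & d c' + p <= d c + q]%N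
    then Y (ix c 0) (ix c' (q - p)) else 0.
Proof. by move=> pd qd; rewrite mxE !blk_ix // !pos_ix. Qed.

Lemma Jordan_proj_comm Y : Phi Y * A = A * Phi Y.
Proof.
apply/eqP; rewrite -subr_eq0; apply/eqP/matrix_ixP => c c' p q pd qd.
rewrite commutator_entry // [RHS]mxE Jordan_projE //.
case: (eqVneq (lam c) (lam c')) => [e|ne] /=.
  rewrite e subrr mulr0 add0r.
  (* Inside a block the two shifted entries lie on one diagonal and cancel; on the left or bottom
     border the surviving entry violates an inequality of [Phi]. *)
  case: posnP => [q0|q_gt0]; case: ltnP => pd'; rewrite ?subr0 ?sub0r //.
  - by rewrite Jordan_projE // q0 ltn0 andbF oppr0.
  - rewrite !Jordan_projE //; try lia; rewrite e eqxx /=.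
    have -> : (p <= q.-1)%N = (p < q)%N by lia.
    have -> : (d c' + p <= d c + q.-1)%N = (d c' + p.+1 <= d c + q)%N by lia.
    have -> : (q.-1 - p = q - p.+1)%N by lia.
    by rewrite subrr.
  - rewrite Jordan_projE //; try lia.
    have -> : (d c' + p <= d c + q.-1)%N = false by lia.
    by rewrite !andbF.
rewrite mul0r add0r.
case: ifP => q0; [rewrite Jordan_projE ?(negPf ne) //; try lia|];
by case: ifP => pd'; rewrite ?Jordan_projE ?(negPf ne) ?subrr.
Qed.

Section ModuloT.
Variables (t : R) (X : 'M[R]_n).
Hypothesis comX : mxmult t (X * A - A * X).
Local Notation x c c' p q := (X (ix c p) (ix c' q)).

Lemma commutator_rel c c' p q : (p < d c)%N -> (q < d c')%N ->
  x c c' p q * (lam c' - lam c)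
    + (if (0 < q)%N then x c c' p q.-1 else 0)
    - (if (p.+1 < d c)%N then x c c' p.+1 q else 0) \in multiples t.
Proof. by move=> pd qd; rewrite -commutator_entry. Qed.

Lemma comm_mult_lam i j : lam (blk i) != lam (blk j) -> X i j \in multiples t.
Proof.
rewrite -{2}(ixK i) -{2}(ixK j); move: (pos_lt i) (pos_lt j).
move: (blk i) (blk j) (pos i) (pos j) => c c' p q pd qd ne.
(* Up to a unit and modulo t, an entry is determined by its neighbours to the left and below, so q
   increases and p decreases. *)
elim: q p pd qd => [|q IHq] p pd qd;
  (have [m] := ubnP (d c - p)%N; elim: m p pd => // m IHm p pd le_m;
   rewrite -(multiplesMu _ _ (lam_unit ne));
   apply: (multiples_cancel (commutator_rel pd qd)); rewrite ?rpred0 //).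
- by case: ifP => pd'; rewrite ?rpred0 //; apply: IHm => //; lia.
- by apply: IHq => //; lia.
- by case: ifP => pd'; rewrite ?rpred0 //; apply: IHm => //; lia.
Qed.

Lemma commutator_rel_lam c c' p q :
    lam c = lam c' -> (p < d c)%N -> (q < d c')%N ->
  (if (0 < q)%N then x c c' p q.-1 else 0)
    - (if (p.+1 < d c)%N then x c c' p.+1 q else 0) \in multiples t.
Proof.
by move=> e pd qd; have := commutator_rel pd qd; rewrite e subrr mulr0 add0r.
Qed.

(** Going up its diagonal, such an entry reaches the first column of the block, where the recurrence
    has only one term. *)
Lemma comm_mult_pos i j :
  lam (blk i) = lam (blk j) -> (pos j < pos i)%N -> X i j \in multiples t.
Proof.
rewrite -{3}(ixK i) -{3}(ixK j); move: (pos_lt i) (pos_lt j).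
move: (blk i) (blk j) (pos i) (pos j) => c c' p q pd qd e.
elim: q p pd qd => [|q IHq] [//|p] pd qd lt_qp;
  have := commutator_rel_lam e (ltnW pd) qd; rewrite pd /=.
  by rewrite sub0r rpredN.
by rewrite rpredBl // IHq //; lia.
Qed.

(** Going down, the inequality makes the diagonal meet the last row before the last column, and
    there again a single term remains. *)
Lemma comm_mult_rem i j : lam (blk i) = lam (blk j) ->
  (d (blk i) + pos j < d (blk j) + pos i)%N -> X i j \in multiples t.
Proof.
rewrite -{4}(ixK i) -{4}(ixK j); move: (pos_lt i) (pos_lt j).
move: (blk i) (blk j) (pos i) (pos j) => c c' p q pd qd e.
have [m] := ubnP (d c - p)%N; elim: m p q pd qd => // m IHm p q pd qd le_m lt_r.
have := commutator_rel_lam e pd (_ : q.+1 < d c')%N => /= /(_ ltac:(lia)).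
case: ifP => pd'; last by rewrite subr0.
by rewrite rpredBr // IHm //; lia.
Qed.

Lemma comm_mult_shift i j :
    lam (blk i) = lam (blk j) -> (pos i <= pos j)%N ->
  X i j - x (blk i) (blk j) 0 (pos j - pos i) \in multiples t.
Proof.
rewrite -{3}(ixK i) -{3}(ixK j); move: (pos_lt i) (pos_lt j).
move: (blk i) (blk j) (pos i) (pos j) => c c' p q pd qd e.
elim: p q pd qd => [|p IHp] q pd qd le_pq; first by rewrite subn0 subrr rpred0.
have := commutator_rel_lam e (ltnW pd) qd; rewrite pd -rpredN opprB.
have q0 : (0 < q)%N by lia.
have := IHp q.-1 (ltnW pd) ltac:(lia) ltac:(lia).
have -> : (q.-1 - p = q - p.+1)%N by lia.
by rewrite q0 => h1 h2; have := rpredD h2 h1; rewrite addrA subrK.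
Qed.

(** Since [Phi X] commutes with A exactly, the centralizer modulo t lifts to the true
    centralizer. *)
Lemma sub_Jordan_proj : mxmult t (X - Phi X).
Proof.
move=> i j; rewrite subr_mxE mxE.
case: eqP => [e|/eqP ne] /=; last by rewrite subr0 comm_mult_lam.
case: leqP => [le_ij|lt_ji] /=; last by rewrite subr0 comm_mult_pos.
case: leqP => r_ij; last by rewrite subr0 comm_mult_rem.
exact: comm_mult_shift.
Qed.

End ModuloT.

(** * Matrices central modulo t in the centralizer of A *)

Section Center.
Variables (t : R) (M : 'M[R]_n).
Hypothesis cenM :
  forall X, mxmult t (X * A - A * X) -> mxmult t (X * M - M * X).

Lemma mxmult_comm (X : 'M[R]_n) : X * A = A * X -> mxmult t (X * A - A * X).
Proof. by move=> ->; rewrite subrr; apply: mxmult0. Qed.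

Lemma center_commA : mxmult t (M * A - A * M).
Proof. by rewrite -opprB; apply/mxmultN/cenM/mxmult_comm. Qed.

(** M is tested against the projection onto one Jordan block, which commutes with A. *)
Lemma center_blk i j : blk i != blk j -> M i j \in multiples t.
Proof.
move=> ne; pose E : 'M[R]_n := diag_mx (\row_h (blk h == blk i)%:R).
have comE : E * A = A * E.
  apply/matrixP=> a b; rewrite -!mulmxE mul_diag_mx mul_mx_diag !mxE mulrC.
  by case: eqP => [->|_] //; rewrite !(mul0r, mulr0).
have := cenM (mxmult_comm comE) i j.
rewrite subr_mxE -!mulmxE mul_diag_mx mul_mx_diag !mxE eqxx mul1r.
by rewrite eq_sym (negPf ne) mulr0 subr0.
Qed.

Lemma center_diag_pos i :
  M i i - M (ix (blk i) 0) (ix (blk i) 0) \in multiples t.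
Proof.
have := comm_mult_shift center_commA (erefl (lam (blk i))) (leqnn (pos i)).
by rewrite subnn.
Qed.

(* For d c' <= d c the matrix X realizes a map between the two Jordan blocks  *)
(* in the centralizer of A, which M must intertwine.                          *)
Lemma center_diag_lam0 c c' : lam c = lam c' -> (0 < d c' <= d c)%N ->
  M (ix c 0) (ix c 0) - M (ix c' 0) (ix c' 0) \in multiples t.
Proof.
move=> e /andP[d0 le_d]; have d0' : (0 < d c)%N by apply: leq_trans le_d.
pose X := Phi (delta_mx (ix c 0) (ix c' 0)).
have := cenM (mxmult_comm (Jordan_proj_comm _ : X * A = _)) (ix c 0) (ix c' 0).
have Xr j : X (ix c 0) j = (j == ix c' 0)%:R.
  rewrite -(ixK j) Jordan_projE // mxE eqxx subn0 addn0 /= ixK.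
  case: (j =P _) => [->|_]; last by rewrite if_same.
  by rewrite blk_ix // e eqxx pos_ix // addn0 le_d.
have Xc j : X j (ix c' 0) = (j == ix c 0)%:R.
  rewrite -{1}(ixK j) Jordan_projE // mxE leqn0 addn0.
  case: (eqVneq j (ix c 0)) => [->|ne].
    by rewrite blk_ix // pos_ix // e !eqxx addn0 le_d.
  case: ifP => // /and3P[_ /eqP pj _]; case: eqP => // ej.
  by case/eqP: ne; rewrite -(ixK j) pj.
rewrite subr_mxE 2!mxE (bigD1 (ix c' 0)) //= Xr eqxx mul1r.
rewrite big1 ?addr0 => [|j /negPf nj]; last by rewrite Xr nj mul0r.
rewrite (bigD1 (ix c 0)) //= Xc eqxx mulr1.
rewrite big1 ?addr0 => [|j /negPf nj]; last by rewrite Xc nj mulr0.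
by rewrite -rpredN opprB.
Qed.

Lemma center_diag_lam i j : lam (blk i) = lam (blk j) ->
  M i i - M j j \in multiples t.
Proof.
move=> e; have d0 h : (0 < d (blk h))%N by apply: leq_ltn_trans (pos_lt h).
have tM0 : M (ix (blk i) 0) (ix (blk i) 0) - M (ix (blk j) 0) (ix (blk j) 0)
    \in multiples t.
  case/orP: (leq_total (d (blk j)) (d (blk i))) => le_d.
    by apply: center_diag_lam0; rewrite ?d0.
  by rewrite -rpredN opprB; apply: center_diag_lam0; rewrite ?d0.
move: (rpredB (rpredD (center_diag_pos i) tM0) (center_diag_pos j)).
by rewrite subrKA opprB subrKA.
Qed.

Lemma center_diag_comm X : mxmult t (X * A - A * X) ->
  mxmult t (X * diag_mx (\row_i M i i) - diag_mx (\row_i M i i) * X).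
Proof.
move=> comX i j; rewrite subr_mxE -!mulmxE mul_diag_mx mul_mx_diag !mxE.
rewrite [M i i * _]mulrC -mulrBr.
have [e|ne] := eqVneq (lam (blk i)) (lam (blk j)).
  by rewrite multiplesMl // center_diag_lam.
by rewrite multiplesMr // (comm_mult_lam comX).
Qed.

(** Modulo t, M links only indices of the same block, and there both M and X are upper
    triangular. *)
Lemma center_tr X : mxmult t (X * A - A * X) ->
  \tr (M * X) - \sum_i M i i * X i i \in multiples t.
Proof.
move=> comX; rewrite /mxtrace -sumrB rpred_sum // => i _.
rewrite mxE (bigD1 i) //= addrAC subrr add0r rpred_sum // => j ne.
have [e|neb] := eqVneq (blk i) (blk j); last first.
  by rewrite multiplesMr // center_blk.
have el : lam (blk i) = lam (blk j) by rewrite e.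
case: (ltngtP (pos i) (pos j)) => [lt_ij|lt_ji|ep].
- by rewrite multiplesMl // (comm_mult_pos comX).
- by rewrite multiplesMr // (comm_mult_pos center_commA).
- by case/eqP: ne; rewrite -(ixK i) -(ixK j) e ep.
Qed.

End Center.

Lemma Jordan_proj_addZ (t : R) (X Y : 'M[R]_n) :
  Phi (X + t *: Y) = Phi X + t *: Phi Y.
Proof.
by apply/matrixP=> i j; rewrite !mxE; case: ifP; rewrite ?mulr0 ?addr0.
Qed.

Lemma Jordan_proj_id (X : 'M[R]_n) : X * A = A * X -> Phi X = X.
Proof.
move=> comX; have := sub_Jordan_proj (mxmult_comm 0 comX) => /mxmultP[Y].
by rewrite scale0r => /eqP; rewrite subr_eq0 => /eqP.
Qed.

(** * The element A + pB and its centralizer modulo p^l *)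

Section StableElement.
Variables (p : R) (l : nat) (B : 'M[R]_n).
Local Notation t := (p ^+ l).
Hypothesis pp0 : t * t = 0.
Hypothesis p_div : forall m y, (m < l)%N ->
  p ^+ m * y \in multiples (p ^+ m.+1) -> y \in multiples p.
Hypothesis cenB :
  forall X, mxmult t (X * A - A * X) -> mxmult t (X * B - B * X).
Local Notation M := (A + p *: B).

Lemma commutator_add (X : 'M[R]_n) :
  X * M - M * X = (X * A - A * X) + p *: (X * B - B * X).
Proof.
rewrite mulrDr mulrDl -scalerAr -scalerAl scalerBr opprD.
by rewrite addrACA.
Qed.

Lemma stable_center X :
  mxmult t (X * A - A * X) -> mxmult t (X * M - M * X).
Proof.
move=> comX; rewrite commutator_add; apply: mxmultD => // i j.
by rewrite mxE multiplesMl // cenB.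
Qed.

(* By successive approximation: modulo p the element M is A, and a matrix     *)
(* commuting with A modulo p is congruent modulo p to one commuting with A.   *)
Lemma stable_centralizer X :
  mxmult t (X * M - M * X) -> mxmult t (X * A - A * X).
Proof.
move=> comX.
suff [Y [Z [comY ->]]] : exists Y Z : 'M[R]_n,
    Y * A = A * Y /\ X = Y + t *: Z.
  rewrite mulrDl mulrDr comY opprD addrACA subrr add0r -scalerAl -scalerAr.
  by rewrite -scalerBr; apply: mxmultZ.
have {}comX : exists Q, X * M - M * X = t *: Q by apply/mxmultP.
elim: {-2}l (leqnn l) => [|m IHm] le_ml.
  by exists 0, X; rewrite mul0r mulr0 add0r expr0 scale1r.
have [Y [Z [comY defX]]] := IHm (ltnW le_ml).
(* Then Z is congruent to [Phi Z] modulo p, and adding [p ^+ m *: Phi Z] to Y gains one power of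
   p. *)
suff comZ : mxmult p (Z * A - A * Z).
  have /mxmultP[W defW] := sub_Jordan_proj comZ.
  exists (Y + p ^+ m *: Phi Z), W; split.
    by rewrite mulrDl mulrDr comY -scalerAl -scalerAr Jordan_proj_comm.
  by rewrite defX exprSr -scalerA -defW scalerBr -addrA subrKC.
have [Q defQ] := comX.
have /mxmultP[W comYM] : mxmult t (Y * M - M * Y).
  by apply: stable_center; rewrite comY subrr; apply: mxmult0.
have eZ : p ^+ m *: (Z * M - M * Z) = t *: (Q - W).
  move: (M) defQ comYM => M0 defQ comYM.
  rewrite [RHS]scalerBr -defQ -comYM defX mulrDl mulrDr -scalerAl -scalerAr.
  by rewrite scalerBr opprD addrACA [RHS]addrC addKr.
have comZM : mxmult p (Z * M - M * Z).
  (* By [eZ], [p ^+ m] times the entry is a multiple of [p ^+ l], hence of [p ^+ m.+1]. *)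
  move=> i j; apply: (p_div le_ml).
  move/matrixP/(_ i j): eZ; rewrite !mxE => ->.
  rewrite -(subnK le_ml) addnC exprD -!mulrA; exact: mem_multiples.
move: comZM; rewrite commutator_add => comZM.
rewrite -[_ - _](addrK (p *: (Z * B - B * Z))).
by apply: mxmultB => //; apply: mxmultZ.
Qed.

(** * Two kinds of morphisms trivial on the derived subgroup *)

Section DerivedSubgroup.
Variables (gT : finGroupType) (T : {group gT}) (f : gT -> 'M[R]_n).
Hypothesis f1 : f 1%g = 1.
Hypothesis fM : {in T &, {morph f : x y / (x * y)%g >-> x * y}}.
Hypothesis f_comM : {in T, forall g, mxmult t (f g * M - M * f g)}.

Lemma f_comA g : g \in T -> mxmult t (f g * A - A * f g).
Proof. by move/f_comM/stable_centralizer. Qed.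

Lemma fVK g : g \in T -> f g^-1%g * f g = 1.
Proof. by move=> Tg; rewrite -fM ?groupV // mulVg. Qed.

Definition eigenproj (c : R) : 'M[R]_n := diag_mx (\row_i (lam (blk i) == c)%:R).

Lemma eigenproj_idem c : eigenproj c * eigenproj c = eigenproj c.
Proof.
apply/matrixP=> i j; rewrite -!mulmxE mul_diag_mx !mxE.
by case: (_ == c); rewrite ?mul1r ?mul0r ?mul0rn.
Qed.

Lemma eigenproj_comm c X :
  mxmult t (X * A - A * X) -> mxmult t (X * eigenproj c - eigenproj c * X).
Proof.
move=> comX i j; rewrite subr_mxE -!mulmxE mul_diag_mx mul_mx_diag !mxE.
have [->|ne] := eqVneq (lam (blk i)) (lam (blk j)).
  by rewrite mulrC subrr rpred0.
by rewrite -mulrC -mulrBl multiplesMl // (comm_mult_lam comX).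
Qed.

Lemma mulmx_mult0 (X Y : 'M[R]_n) : mxmult t X -> mxmult t Y -> X * Y = 0.
Proof.
move=> /mxmultP[U ->] /mxmultP[V ->].
by rewrite -scalerAl -scalerAr scalerA pp0 scale0r.
Qed.

(** The determinant of the compression of [f g] to the generalized eigenspace of c, completed by the
    identity on the complement. *)
Definition eigendet c g : R :=
  \det (eigenproj c * f g * eigenproj c + (1 - eigenproj c)).

Lemma eigendet1 c : eigendet c 1%g = 1.
Proof. by rewrite /eigendet f1 mulr1 eigenproj_idem addrC subrK det1. Qed.

(** The matrices commute with the projection modulo t only, but the product of two off-diagonal
    corners is a multiple of [t * t], which is 0. *)
Lemma eigendetM c : {in T &, {morph eigendet c : x y / (x * y)%g >-> x * y}}.
Proof.
move=> x y Tx Ty; rewrite /eigendet fM // -det_mulmx mulmxE; congr (\det _).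
set e := eigenproj c; have ee : e * e = e := eigenproj_idem c.
have comx : mxmult t (e * f x * (1 - e)).
  have := mxmultMl (-e) (eigenproj_comm c (f_comA Tx)).
  rewrite -/e mulmxE mulrBr !mulNr opprK !mulrA ee.
  by rewrite mulrBr mulr1 addrC.
have comy : mxmult t ((1 - e) * f y * e).
  have := mxmultMr e (eigenproj_comm c (f_comA Ty)).
  rewrite -/e mulmxE mulrBl -!mulrA ee.
  by rewrite mulrBl mul1r.
have d0 : (1 - e) * (1 - e) = 1 - e.
  by rewrite mulrBl mul1r mulrBr mulr1 ee subrr subr0.
have de : (1 - e) * e = 0 by rewrite mulrBl mul1r ee subrr.
have ed : e * (1 - e) = 0 by rewrite mulrBr mulr1 ee subrr.
(* An opaque name keeps distributivity from expanding [1 - e]. *)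
have [e' e'E] : exists e', e' = 1 - e by exists (1 - e).
rewrite -e'E in comx comy d0 de ed *.
rewrite mulrDl !mulrDr d0.
have -> : e * f x * e * e' = 0 by rewrite -mulrA ed mulr0.
have -> : e' * (e * f y * e) = 0 by rewrite !mulrA de !mul0r.
rewrite addr0 add0r; congr (_ + _).
have := mulmx_mult0 comx comy.
rewrite !mulrA -[_ * e' * e']mulrA d0 e'E mulrBr mulr1 !mulrBl => /eqP.
by rewrite subr_eq0 => /eqP ->; rewrite -[_ * e * e]mulrA ee.
Qed.

Definition nilpart : 'M[R]_n := M - diag_mx (\row_i M i i).

Lemma nilpart_comm X :
  mxmult t (X * A - A * X) -> mxmult t (X * nilpart - nilpart * X).
Proof.
move=> comX; rewrite mulrBr mulrBl opprD addrACA -opprD.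
apply: mxmultB; first exact: stable_center.
exact (center_diag_comm stable_center comX).
Qed.

Lemma nilpart_tr X : mxmult t (X * A - A * X) -> \tr (nilpart * X) \in multiples t.
Proof.
move=> comX.
suff -> : \tr (nilpart * X) = \tr (M * X) - \sum_i M i i * X i i.
  exact (center_tr stable_center comX).
rewrite mulrBl linearB; congr (_ - _).
by apply: eq_bigr => i _; rewrite -mulmxE mul_diag_mx mxE [in LHS]mxE.
Qed.

(* Additive because [nilpart] pairs to zero with the centralizer of A modulo  *)
(* t, so that [Phi] may be treated as if it were multiplicative.              *)
Definition nilcocycle g : R := \tr (nilpart * f g^-1%g * (f g - Phi (f g))).

Lemma mxmult_commM X Y : mxmult t (X * A - A * X) -> mxmult t (Y * A - A * Y) ->
  mxmult t (X * Y * A - A * (X * Y)).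
Proof.
move=> comX comY.
have -> : X * Y * A - A * (X * Y) = X * (Y * A - A * Y) + (X * A - A * X) * Y.
  by rewrite mulrBr mulrBl !mulrA subrKA.
by apply: mxmultD; [apply: mxmultMl|apply: mxmultMr].
Qed.

Lemma nilcocycleM :
  {in T &, forall x y, nilcocycle (x * y)%g = nilcocycle x + nilcocycle y}.
Proof.
move=> x y Tx Ty; rewrite /nilcocycle invMg !fM ?groupV //.
have [fVx fVy] := (f_comA (groupVr Tx), f_comA (groupVr Ty)).
have fVKx := fVK Tx; have fVKy : f y * f y^-1%g = 1.
  by rewrite -fM ?groupV // mulgV.
have /mxmultP[X defX] := sub_Jordan_proj (f_comA Tx).
have /mxmultP[Y defY] := sub_Jordan_proj (f_comA Ty).
have /mxmultP[Q defQ] := nilpart_comm (f_comA Ty).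
move: (f x) (f y) (f x^-1%g) (f y^-1%g) fVx fVy fVKx fVKy defX defY defQ.
move=> a b a' b' coma' comb' a'a bb' defX defY defQ; rewrite defX defY.
pose W := X * b + a * Y.
(* The product [Phi a * Phi b] lies in the centralizer of A and is fixed by [Phi], so only W
   matters. *)
have eab : a * b = Phi a * Phi b + t *: W.
  have -> : t *: W = (a - Phi a) * b + a * (b - Phi b).
    by rewrite scalerDr defX defY scalerAl scalerAr.
  have -> : a * (b - Phi b) = Phi a * (b - Phi b).
    apply/eqP; rewrite -subr_eq0 -mulrBl defX defY mulmx_mult0 //;
    exact: mxmultZ.
  by rewrite mulrBl mulrBr subrKA subrKC.
have eW : a * b - Phi (a * b) = t *: (W - Phi W).
  rewrite eab Jordan_proj_addZ [Phi (_ * _)]Jordan_proj_id; last first.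
    by rewrite -mulrA Jordan_proj_comm mulrA Jordan_proj_comm mulrA.
  by rewrite opprD addrACA subrr add0r scalerBr.
rewrite eW -!scalerAr !mxtraceZ -mulrDr [_ * (W - _)]mulrBr raddfB /= mulrBr.
have -> : t * \tr (nilpart * (b' * a') * Phi W) = 0.
  rewrite -[nilpart * _ * _]mulrA.
  have /multiplesP[u ->] : \tr (nilpart * (b' * a' * Phi W)) \in multiples t.
    apply: nilpart_tr; apply: mxmult_commM; first exact: mxmult_commM.
    by apply: mxmult_comm; apply: Jordan_proj_comm.
  by rewrite mulrA pp0 mul0r.
rewrite subr0 /W mulrDr raddfD /= !mulrDr; congr (_ + _); last first.
  by rewrite !mulrA -[_ * a' * a]mulrA a'a mulr1.
(* Move b to the front by cyclicity and past [nilpart], with which it commutes modulo t, so that it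
   cancels [b']. *)
have -> : \tr (nilpart * (b' * a') * (X * b))
    = \tr (nilpart * a' * X) + t * \tr (Q * b' * a' * X).
  move: nilpart defQ => m defQ.
  rewrite [_ * (X * b)]mulrA -mulmxE [LHS]mxtrace_mulC mulmxE !mulrA.
  have -> : b * m = m * b + t *: Q by rewrite -defQ subrKC.
  by rewrite !mulrDl raddfD /= -[_ * b * b']mulrA bb' mulr1 -!scalerAl mxtraceZ.
by rewrite mulrDr mulrA pp0 mul0r addr0.
Qed.

Lemma nilcocycle_mult g : g \in T -> nilcocycle g \in multiples t.
Proof.
move=> Tg; rewrite /nilcocycle.
have /mxmultP[Y ->] := sub_Jordan_proj (f_comA Tg).
by rewrite -scalerAr mxtraceZ mem_multiples.
Qed.

Lemma nilcocycle1 : nilcocycle 1%g = 0.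
Proof.
rewrite /nilcocycle invg1 f1 Jordan_proj_id ?mul1r ?mulr1 //.
by rewrite subrr mulr0 mxtrace0.
Qed.

(** The values of [nilcocycle] are multiples of t, so [1 + nilcocycle] is multiplicative and equals
    1 at z. At 1 + t X the cocycle is t tr(nilpart X), since [Phi X] pairs to zero and the terms in
    [t * t] vanish. *)
Lemma der1_nilpart z X :
  z \in T^`(1)%g -> f z = 1 + t *: X -> t * \tr (nilpart * X) = 0.
Proof.
move=> T'z fz; have Tz : z \in T by apply: (subsetP (der_sub 1 T)).
have cz : nilcocycle z = 0.
  apply: (addrI (1 : R)); rewrite addr0.
  apply: (@multiplicative_der1 _ T _ (fun g => 1 + nilcocycle g)) => //=.
    by rewrite nilcocycle1 addr0.
  move=> x y Tx Ty; rewrite nilcocycleM // mulrDl mulrDr !mulr1 mul1r.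
  have /multiplesP[u ->] := nilcocycle_mult Tx.
  have /multiplesP[v ->] := nilcocycle_mult Ty.
  by rewrite mulrDr mulr1 mulrACA pp0 mul0r addr0 -addrA [t * v + _]addrC.
have fVz : f z^-1%g = 1 - t *: (f z^-1%g * X).
  have := fVK Tz; rewrite fz mulrDr mulr1 -scalerAr => <-.
  by rewrite addrK.
move: cz; rewrite /nilcocycle fz Jordan_proj_addZ Jordan_proj_id; last first.
  by rewrite mul1r mulr1.
rewrite opprD addrACA subrr add0r -scalerBr -scalerAr mxtraceZ fVz.
rewrite [nilpart * (1 - _)]mulrBr mulr1 [(nilpart - _) * _]mulrBl raddfB mulrBr /=.
rewrite -scalerAr -[in X in _ - X]scalerAl mxtraceZ [X in _ - X]mulrA.
rewrite pp0 mul0r subr0.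
rewrite [nilpart * (X - _)]mulrBr raddfB mulrBr /=.
have /multiplesP[u ->] : \tr (nilpart * Phi X) \in multiples t.
  by apply/nilpart_tr/mxmult_comm/Jordan_proj_comm.
by rewrite [X in _ - X]mulrA pp0 mul0r subr0.
Qed.

Lemma der1_eigenproj z X c :
  z \in T^`(1)%g -> f z = 1 + t *: X -> t * \tr (eigenproj c * X) = 0.
Proof.
move=> T'z fz; apply: (addrI (1 : R)); rewrite addr0.
rewrite -[RHS](multiplicative_der1 (eigendet1 c) (@eigendetM c) T'z) /eigendet fz.
rewrite mulrDr mulrDl mulr1 eigenproj_idem addrAC [eigenproj c + _]addrC subrK.
rewrite -scalerAr -scalerAl det_addr_sqr0 //; congr (_ + _ * _).
by rewrite -mulmxE [RHS]mxtrace_mulC mulmxA mulmxE eigenproj_idem.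
Qed.

Lemma der1_tr0 z X :
  z \in T^`(1)%g -> f z = 1 + t *: X -> t * \tr (M * X) = 0.
Proof.
move=> T'z fz; rewrite -[M](subrK (diag_mx (\row_i M i i))) -/nilpart.
rewrite mulrDl raddfD mulrDr /= (der1_nilpart T'z fz) add0r.
rewrite /mxtrace mulr_sumr (partition_big (fun i => lam (blk i)) xpredT) //=.
rewrite big1 // => c _.
(* The diagonal of M is constant modulo t on the eigenvalue c, so the entry at [i0] stands for all
   and factors out of the trace. *)
case: (pickP (fun i => lam (blk i) == c)) => [i0 /eqP lam_i0|nolam]; last first.
  by rewrite big_pred0.
have := der1_eigenproj c T'z fz; rewrite /mxtrace mulr_sumr => sum0.
have diagM i : lam (blk i) = c -> M i i - M i0 i0 \in multiples t.
  by move=> lam_i; apply: (center_diag_lam stable_center); rewrite lam_i lam_i0.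
move: (M) diagM => M0 diagM.
transitivity (M0 i0 i0 * \sum_i t * (eigenproj c * X) i i); last first.
  by rewrite sum0 mulr0.
rewrite mulr_sumr.
rewrite big_mkcond /=; apply: eq_bigr => i _.
rewrite -!mulmxE !mul_diag_mx !mxE; case: eqP => [lam_i|_]; last first.
  by rewrite mul0r !mulr0.
have /multiplesP[u eu] := diagM i lam_i.
rewrite mul1r -[M0 i i](subrK (M0 i0 i0)) eu mulrDl mulrDr -mulrA.
by rewrite [t * (t * _)]mulrA pp0 mul0r add0r mulrCA.
Qed.

End DerivedSubgroup.
End StableElement.
End JordanCentralizer.

(** * Divisibility and units in the rings O_s *)

Section ResidueRings.
Variables (F : fieldType) (K : localField F) (pi : idgen K).
Local Notation O := (intring K).
Local Notation v := (lval K).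

Lemma idgen_neq0 : val (pi : O) != 0.
Proof. by case/andP: (genvalP pi). Qed.

Lemma val_ge_mulX (m : nat) n (x : F) :
  val_ge v (m%:Z + n) (val (pi : O) ^+ m * x) = val_ge v n x.
Proof.
rewrite /val_ge mulf_eq0 expf_eq0 (negPf idgen_neq0) andbF /=.
case: eqVneq => //= x0.
by rewrite lvalM ?expf_neq0 ?idgen_neq0 // lval_idgenX lerD2l.
Qed.

Lemma val_ge_dvd (m : nat) (x : O) :
  val_ge v m (val x) -> exists y : O, x = (pi : O) ^+ m * y.
Proof.
move=> vx; set t := val (pi : O) ^+ m.
have t0 : t != 0 by rewrite expf_neq0 // idgen_neq0.
have vy : val x / t \in integral K.
  by rewrite inE /= -(val_ge_mulX m) addr0 mulrC divfK.
by exists (IntRing vy); apply: val_inj; rewrite rmorphM rmorphXn /= mulrC divfK.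
Qed.

Lemma redO_eq0 s (x : O) : (0 < s)%N -> (redO s x == 0) = val_ge v s (val x).
Proof. by move=> s0; rewrite -(rmorph0 (redO s)) redO_eq subr0 prednK. Qed.

Lemma redO_multiples r m (x : O) : (m <= r)%N ->
  (redO r x \in multiples (redO r pi ^+ m)) = val_ge v m (val x).
Proof.
move=> le_mr; apply/idP/idP => [/multiplesP[y]|/val_ge_dvd[y ->]]; last first.
  by rewrite rmorphM rmorphXn mem_multiples.
rewrite -(liftOK y) -rmorphXn -rmorphM => /eqP; rewrite redO_eq => vxy.
rewrite -[val x](subrK (val ((pi : O) ^+ m * liftO y))); apply: lvalD.
  by apply: val_geW vxy; rewrite lez_nat; lia.
rewrite rmorphM rmorphXn -[Posz m]addr0 val_ge_mulX; exact: (valP (liftO y)).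
Qed.

(** The criterion does not depend on s, so invertibility passes between [O_l] and [O_r]. *)
Lemma redO_unit s (x : O) :
  (redO s x \is a GRing.unit) = ~~ val_ge v 1 (val x).
Proof.
apply/idP/idP => [/unitrP[y [yx _]]|nvx].
  apply/negP=> vx; move: yx; rewrite -(liftOK y) -rmorphM -(rmorph1 (redO s)).
  move/eqP; rewrite redO_eq => vyx.
  have {vyx}vyx1 : val_ge v 1 (val (liftO y * x) - val (1 : O)).
    by apply: val_geW vyx; rewrite lez_nat.
  have vyx : val_ge v 1 (val (liftO y * x)).
    by rewrite rmorphM -[1]add0r; apply: val_geM vx; apply: (valP (liftO y)).
  have := val_geB vyx vyx1; rewrite opprB addrC subrK rmorph1 /val_ge lval1.
  by rewrite (negPf (oner_neq0 _)).
have x0 : val x != 0 by apply: contraNneq nvx; rewrite /val_ge => ->; rewrite eqxx.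
have vx : v (val x) = 0.
  have := valP x; move: nvx; rewrite inE /= /val_ge (negPf x0) /=; lia.
have vxV : (val x)^-1 \in integral K.
  rewrite inE /val_ge /= invr_eq0 (negPf x0) /=.
  have := lvalM K x0 (invr_neq0 x0); rewrite divff // lval1 vx add0r => <-.
  exact: lexx.
apply/unitrP; exists (redO s (IntRing vxV)); rewrite -!rmorphM -(rmorph1 (redO s)).
by split; congr redO; apply: val_inj; rewrite rmorphM /= ?mulVf ?divff // rmorph1.
Qed.

Definition lift_mx s m n (X : 'M[resring K s]_(m, n)) : 'M[O]_(m, n) :=
  map_mx (@liftO F K s) X.

Lemma lift_mxK s m n (X : 'M[resring K s]_(m, n)) : map_mx (redO s) (lift_mx X) = X.
Proof. by apply/matrixP=> i j; rewrite !mxE liftOK. Qed.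

(** Translates between congruences in [O_r], where the group lives, and equalities in [O_l], where
    the stable matrix is given. *)
Lemma redO_mxmult r l m n (X : 'M[O]_(m, n)) : (0 < l <= r)%N ->
  mxmult (redO r pi ^+ l) (map_mx (redO r) X) <-> map_mx (redO l) X = 0.
Proof.
case/andP=> l0 le_lr; split=> [tX|X0 i j].
  apply/matrixP=> i j; apply/eqP; rewrite !mxE redO_eq0 //.
  by rewrite -(redO_multiples _ le_lr); have := tX i j; rewrite mxE.
by move/matrixP/(_ i j)/eqP: X0; rewrite !mxE redO_eq0 // redO_multiples.
Qed.

Lemma redO_idgen_div r m (y : resring K r) : (m < r)%N ->
  redO r pi ^+ m * y \in multiples (redO r pi ^+ m.+1) ->
  y \in multiples (redO r pi).
Proof.
move=> lt_mr; rewrite -(liftOK y) -rmorphXn -rmorphM redO_multiples //.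
rewrite rmorphM rmorphXn -addn1 PoszD val_ge_mulX -[redO r pi]expr1 redO_multiples //.
by apply: leq_ltn_trans lt_mr.
Qed.

End ResidueRings.

(** * The characters psi_M and their stabilizers *)

Section CongruenceCharacter.
Variables (F : fieldType) (K : localField F) (pi : idgen K).
Variables (psi : F -> algC) (N l : nat).
Hypothesis hpsi : additive_char K psi.
Hypothesis l_gt0 : (0 < l)%N.
Local Notation O := (intring K).
Local Notation v := (lval K).
Local Notation r := (2 * l)%N.
Local Notation R := (resring K r).
Local Notation n := N.-1.+1.
Local Notation p := (redO r (pi : O)).
Local Notation t := (p ^+ l).
Local Notation Kl := (congrGL_group pi N r l).

Lemma r_gt0 : (0 < r)%N. Proof. by rewrite muln_gt0. Qed.

Lemma idgenX_sqr0 : t * t = 0.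
Proof. by apply/eqP; rewrite -exprD redO_idgenX ?r_gt0 // mul2n addnn. Qed.

Definition res_psi (a : R) : algC := psi (val (pi : O) ^- l * val (liftO a)).

Lemma psi_int (x : F) : val_ge v 0 x -> psi x = 1.
Proof. by case: hpsi => _ + _; apply. Qed.

Lemma psiD : {morph psi : x y / x + y >-> x * y}.
Proof. by case: hpsi. Qed.

Lemma idgenXV_mul (x : F) m : val_ge v (l%:Z + m) x ->
  val_ge v m (val (pi : O) ^- l * x).
Proof.
move=> vx; rewrite -(val_ge_mulX pi l) mulrA divff ?mul1r //.
by rewrite expf_neq0 // idgen_neq0.
Qed.

Lemma res_psi_redO (a : O) : res_psi (redO r a) = psi (val (pi : O) ^- l * val a).
Proof.
rewrite -[_ * val a](subrK (val (pi : O) ^- l * val (liftO (redO r a)))).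
rewrite psiD psi_int ?mul1r // -mulrBr idgenXV_mul // addr0.
have /eqP : redO r a = redO r (liftO (redO r a)) by rewrite liftOK.
by rewrite redO_eq; apply: val_geW; rewrite lez_nat; lia.
Qed.

Lemma res_psiD : {morph res_psi : a b / a + b >-> a * b}.
Proof.
move=> a b; rewrite -(liftOK a) -(liftOK b) -rmorphD !res_psi_redO.
by rewrite rmorphD mulrDr psiD.
Qed.

Lemma res_psi0 : res_psi 0 = 1.
Proof.
rewrite -(rmorph0 (redO r)) res_psi_redO rmorph0 mulr0 psi_int //.
by rewrite /val_ge eqxx.
Qed.

Lemma res_psi_mult0 a : t * a = 0 -> res_psi a = 1.
Proof.
rewrite -(liftOK a) -rmorphXn -rmorphM => /eqP; rewrite redO_eq0 ?r_gt0 //.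
have -> : r%:Z = l%:Z + l%:Z by rewrite mul2n -addnn PoszD.
rewrite rmorphM rmorphXn val_ge_mulX => va.
by rewrite res_psi_redO psi_int // idgenXV_mul // addr0.
Qed.

Lemma res_psi_nondeg (y : R) :
  (forall z, res_psi (y * z) = 1) -> y \in multiples t.
Proof.
rewrite -(liftOK y); move: (liftO y) => {}y psi1.
rewrite redO_multiples; last by lia.
apply: contraT => nvy; have [_ _ [x vx]] := hpsi; case/eqP.
have y0 : val y != 0 by apply: contraNneq nvy; rewrite /val_ge => ->; rewrite eqxx.
pose q := val (pi : O) ^+ l; have q0 : q != 0 by rewrite expf_neq0 // idgen_neq0.
(* This z makes pi^-l y z equal to x, where [psi] is not 1; it is integral because v(x) >= -1 and
   v(y) < l. *)
have vz : q * x / val y \in integral K.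
  rewrite inE /= /val_ge; case: (eqVneq (q * x / val y) 0) => //= z0.
  move: (z0); rewrite !mulf_eq0 invr_eq0 (negPf q0) (negPf y0) orbF /= => x0.
  have := lvalM K z0 y0; rewrite divfK // lvalM // lval_idgenX.
  move: vx nvy; rewrite /val_ge (negPf x0) (negPf y0) /=; lia.
have := psi1 (redO r (IntRing vz)); rewrite -rmorphM res_psi_redO rmorphM /=.
by rewrite [val y * _]mulrC divfK // mulKf.
Qed.

Variable M : 'M[resring K l]_n.
Local Notation m := (map_mx (redO r) (lift_mx M)).
Local Notation psiM := (psi_char pi psi l_gt0 M).

Lemma psi_char_tr (g : {'GL_N[R]}) (x : 'M[R]_n) :
  GLval g = 1 + t *: x -> psiM g = res_psi (\tr (m * x)).
Proof.
move=> gE; rewrite -{1}(lift_mxK M).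
rewrite (psi_charE l_gt0 (x := lift_mx x) _ hpsi) ?lift_mxK //.
rewrite -[in RHS](lift_mxK x) -mulmxE -(map_mxM (redO r)) trace_map_mx res_psi_redO.
by rewrite -trace_map_mx map_mxM.
Qed.

Lemma psi_char_lin : psiM \is a linear_char.
Proof.
apply: morph_lin_char => [|g h /congrGLP[x gE] /congrGLP[y hE]].
  by rewrite (@psi_char_tr _ 0) ?scaler0 ?addr0 // mulr0 mxtrace0 res_psi0.
rewrite (psi_char_tr gE) (psi_char_tr hE) -res_psiD -mxtraceD -mulrDr.
apply: psi_char_tr; rewrite GL_ME gE hE mulrDl mul1r mulrDr mulr1.
rewrite -scalerAl -scalerAr scalerA idgenX_sqr0 scale0r addr0 scalerDr.
by rewrite addrAC addrA.
Qed.

Lemma congrGL_normal : (Kl <| 'GL_N[R])%g.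
Proof.
apply/andP; split; first by apply/subsetP=> g; rewrite inE.
apply/subsetP=> g _; rewrite inE; apply/subsetP=> _ /imsetP[h /congrGLP[x hE] ->].
apply/congrGLP; exists (GLval g^-1%g * x * GLval g).
rewrite conjgE !GL_ME hE mulrDl mul1r mulrDr -GL_ME mulVg; congr (_ + _).
by rewrite -scalerAl -scalerAr !mulrA.
Qed.

Lemma congrGL_exists (x : 'M[R]_n) : exists2 g, g \in Kl & GLval g = 1 + t *: x.
Proof.
have U : 1 + t *: x \is a GRing.unit.
  apply/unitrP; exists (1 - t *: x).
  have yy : t *: x * (t *: x) = 0.
    by rewrite -scalerAl -scalerAr scalerA idgenX_sqr0 scale0r.
  split; first by rewrite mulrBl mul1r mulrDr mulr1 yy addr0 addrK.
  by rewrite mulrDl mul1r mulrBr mulr1 yy subr0 subrK.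
by exists (FinRing.Unit U) => //; apply/congrGLP; exists x.
Qed.

Lemma inertia_comm_mult g : (g \in 'I_('GL_N[R])[psiM])%g ->
  mxmult t (GLval g * m - m * GLval g).
Proof.
case/setIP=> _ Ig.
have gV : GLval g^-1%g * GLval g = 1 by rewrite -GL_ME mulVg.
suff tW : mxmult t (GLval g * m * GLval g^-1%g - m).
  have := mxmultMr (GLval g) tW.
  by rewrite mulmxE mulrBl -!mulrA gV mulr1.
move=> i j; apply: res_psi_nondeg => z.
(* Testing on this element isolates the entry (i, j) of g m g^-1 - m. *)
have [h Kh hE] := congrGL_exists (z *: delta_mx j i).
have := inertia_valJ h Ig; set x := _ *: delta_mx _ _ in hE *.
rewrite (psi_char_tr hE) (@psi_char_tr _ (GLval g^-1%g * x * GLval g)); last first.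
  rewrite conjgE !GL_ME hE mulrDl mul1r mulrDr -GL_ME mulVg; congr (_ + _).
  by rewrite -scalerAl -scalerAr !mulrA.
have -> : \tr (m * (GLval g^-1%g * x * GLval g))
  = \tr ((GLval g * m * GLval g^-1%g - m) * x) + \tr (m * x).
  rewrite -mxtraceD mulrBl subrK !mulrA -mulmxE [LHS]mxtrace_mulC.
  by rewrite !mulmxA.
rewrite res_psiD => /eqP; rewrite -subr_eq0 -[X in _ - X]mul1r -mulrBl mulf_eq0.
have -> : \tr ((GLval g * m * GLval g^-1%g - m) * x)
    = (GLval g * m * GLval g^-1%g - m) i j * z.
  rewrite -scalerAr mxtraceZ mulrC; congr (_ * _).
  rewrite /mxtrace (bigD1 i) //= big1 ?addr0.
    rewrite -mulmxE mxE (bigD1 j) //= big1 ?addr0.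
      by rewrite [delta_mx _ _ _ _]mxE !eqxx mulr1.
    by move=> k /negPf nk; rewrite [delta_mx _ _ _ _]mxE nk mulr0.
  move=> k /negPf nk; rewrite -mulmxE mxE big1 // => h' _.
  by rewrite [delta_mx _ _ _ _]mxE nk andbF mulr0.
case/orP; first by rewrite subr_eq0 => /eqP.
suff : res_psi (\tr (m * x)) != 0 by move/negPf->.
apply: contraTneq (oner_neq0 algC) => e; rewrite -res_psi0.
by rewrite -(subrr (\tr (m * x))) res_psiD e mul0r eqxx.
Qed.

End CongruenceCharacter.

(** * Base change to an unramified extension *)

Section UnramifiedExtension.
Variables (F : fieldType) (K : localField F) (E : unramifiedExt K).
Local Notation L := (ue_local E).

Lemma ext_val_ge n (x : F) : val_ge (lval L) n x%:A = val_ge (lval K) n x.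
Proof.
rewrite /val_ge scaler_eq0 oner_eq0 orbF.
by case: eqVneq => //= x0; rewrite ue_val.
Qed.

Fact extO_zmod_morphism : zmod_morphism (extO E).
Proof. move=> x y; apply: val_inj.
by rewrite -[LHS]/((val (x - y))%:A) !rmorphB scalerBl. Qed.

Fact extO_monoid_morphism : monoid_morphism (extO E).
Proof.
split=> [|x y]; apply: val_inj.
  by rewrite -[LHS]/((val (1 : intring K))%:A) !rmorph1 scale1r.
by rewrite -[LHS]/((val (x * y))%:A) !rmorphM /= -scalerAl mul1r scalerA.
Qed.

HB.instance Definition _ :=
  GRing.isZmodMorphism.Build (intring K) (intring L) (extO E) extO_zmod_morphism.
HB.instance Definition _ :=
  GRing.isMonoidMorphism.Build (intring K) (intring L) (extO E)
    extO_monoid_morphism.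

Lemma ext_res_redO s (x : intring K) :
  ext_res E (redO s x) = redO s (extO E x).
Proof.
apply/eqP; rewrite redO_eq.
rewrite (_ : _ - _ = (val (liftO (redO s x)) - val x)%:A); last first.
  by rewrite scalerBl.
by rewrite ext_val_ge -redO_eq liftOK.
Qed.

Fact ext_res_zmod_morphism s : zmod_morphism (@ext_res F K E s).
Proof.
by move=> x y; rewrite -(liftOK x) -(liftOK y) -rmorphB !ext_res_redO !rmorphB.
Qed.

Fact ext_res_monoid_morphism s : monoid_morphism (@ext_res F K E s).
Proof.
split=> [|x y]; first by rewrite -(rmorph1 (redO s)) ext_res_redO !rmorph1.
by rewrite -(liftOK x) -(liftOK y) -rmorphM !ext_res_redO !rmorphM.
Qed.

HB.instance Definition _ s :=
  GRing.isZmodMorphism.Build (resring K s) (resring L s) (@ext_res F K E s)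
    (@ext_res_zmod_morphism s).
HB.instance Definition _ s :=
  GRing.isMonoidMorphism.Build (resring K s) (resring L s) (@ext_res F K E s)
    (@ext_res_monoid_morphism s).

(** Injectivity holds as the valuation is preserved; it brings the vanishing of a trace back from
    the extension. *)
Lemma ext_res_eq0 s (x : resring K s) : (ext_res E x == 0) = (x == 0).
Proof.
rewrite -(liftOK x) ext_res_redO -(rmorph0 (redO s)) -[in RHS](rmorph0 (redO s)).
by rewrite !redO_eq !subr0 /= ext_val_ge.
Qed.

Variable pi : idgen K.

Fact ext_idgen_subproof :
  (intval (extO E pi) != 0) && (lval L (extO E pi) == 1).
Proof.
by case/andP: (genvalP pi) => p0 /eqP vp; rewrite /= ue_val // vp
  scaler_eq0 oner_eq0 orbF p0 eqxx.
Qed.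

Definition ext_idgen : idgen L := IdGen ext_idgen_subproof.

End UnramifiedExtension.

(** * Jordan forms in terms of blocks and positions *)

Section JordanFormIndices.
Variables (R : nzRingType) (n' : nat).
Local Notation n := n'.+1.

Lemma Jordan_formP (A : 'M[R]_n) : Jordan_form A ->
  exists (k : nat) (blk : 'I_n -> 'I_k) (pos : 'I_n -> nat) (d : 'I_k -> nat)
    (ix : 'I_k -> nat -> 'I_n) (lam : 'I_k -> R),
    [/\ forall i, (pos i < d (blk i))%N, forall i, ix (blk i) (pos i) = i,
        forall c q, (q < d c)%N -> blk (ix c q) = c /\ pos (ix c q) = q,
        forall c, (0 < d c)%N
      & A = \matrix_(i, j) if blk i == blk j
              then if pos i == pos j then lam (blk i)
                   else (pos j == (pos i).+1)%:R
              else 0].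
Proof.
case=> k [d [lam [e [d0 ->]]]].
pose blk (i : 'I_n) := tagnat.sig1 (cast_ord (esym e) i).
pose pos (i : 'I_n) : nat := tagnat.sig2 (cast_ord (esym e) i).
(* The value [ord0] is a default for positions outside the block. *)
pose ix (c : 'I_k) (q : nat) : 'I_n :=
  if insub q is Some j then cast_ord e (tagnat.Rank c (j : 'I_(d c))) else ord0.
exists k, blk, pos, d, ix, lam; split=> //.
- by move=> i; apply: ltn_ord.
- move=> i; rewrite /ix insubT ?ltn_ord // => lt_i; apply: (canLR (cast_ordKV _)).
  rewrite -[RHS]tagnat.sig2K; congr tagnat.Rank; exact: val_inj.
- move=> c q lt_q; rewrite /ix insubT /blk /pos cast_ordK.
  by split; [apply: tagnat.Rank1K|rewrite tagnat.Rank2K].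
- apply/matrixP=> i j; rewrite castmxE !mxE /blk /pos /=.
  move: (cast_ord _ i) (cast_ord _ j) => {}i {}j.
  move: (tagnat.sig2 i) (tagnat.sig2 j).
  move: (tagnat.sig1 i) (tagnat.sig1 j) => c c' a b.
  case: (c =P c') => [ec|_]; last by rewrite mxE.
  by case: _ / ec in b *; rewrite conform_mx_id mxE.
Qed.

End JordanFormIndices.

(** * Vanishing of the trace on the derived subgroup *)

Section StableCommutators.
Variables (F : fieldType) (K : localField F) (pi : idgen K) (N l : nat).
Hypothesis l_gt0 : (0 < l)%N.
Local Notation r := (2 * l)%N.
Local Notation R := (resring K r).
Local Notation n := N.-1.+1.
Local Notation t := (redO r pi ^+ l).

(** The data of stability live over [O_l]; they are lifted to [O_r] of the extension so that
    [der1_tr0] applies to the conjugated image of T. *)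
Lemma stable_der1_tr (M : 'M[resring K l]_n) (T : {group {'GL_N[R]}})
    (z : {'GL_N[R]}) (x : 'M[R]_n) (m := map_mx (redO r) (lift_mx M)) :
    stable_mx pi M ->
    {in T, forall g, mxmult t (GLval g * m - m * GLval g)} ->
    z \in T^`(1)%g -> GLval z = 1 + t *: x ->
  t * \tr (m * x) = 0.
Proof.
case=> E [mu [P [A [B [[muM muK] [UP defM] JA Amu [comBA cenBA]]]]]] comT T'z zE.
have [k [blk [pos [d [ix [lam [pos_lt ixK ix_blk_pos d_gt0 defA]]]]]]] :=
  Jordan_formP JA.
have l_r : (0 < l <= r)%N by lia.
set L := ue_local E in mu muM muK P A B UP defM JA Amu comBA cenBA lam defA.
pose piE : idgen L := ext_idgen E pi.
have blk_ix c q : (q < d c)%N -> blk (ix c q) = c by case/ix_blk_pos.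
have pos_ix c q : (q < d c)%N -> pos (ix c q) = q by case/ix_blk_pos.
pose res c : resring L 1 := redO 1 (liftO (lam c)).
have lam_mu c : lam c = redO l (mu (res c)).
  have /matrixP/(_ (ix c 0) (ix c 0)) := Amu.
  by rewrite defA !mxE !eqxx blk_ix.
(* Lifting eigenvalues through [mu] keeps them functions of their residues, so distinct ones still
   differ by units. P and B may be lifted arbitrarily. *)
pose lamr c : resring L r := redO r (mu (res c)).
have lam_unit c c' : lamr c != lamr c' -> lamr c' - lamr c \is a GRing.unit.
  move=> ne; rewrite -rmorphB redO_unit -(redO_eq0 (s := 1)) // rmorphB /= subr_eq0 !muK.
  by apply: contraNneq ne => e; rewrite /lamr e.
pose Ar := Jordan_of blk pos lamr.
pose Ao : 'M[intring L]_n := \matrix_(i, j) if blk i == blk j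
  then if pos i == pos j then mu (res (blk i)) else (pos j == (pos i).+1)%:R
  else 0.
have redrAo : map_mx (redO r) Ao = Ar.
  apply/matrixP=> i j; rewrite !mxE.
  case: ifP => _; last by rewrite rmorph0.
  by case: ifP => _ //; rewrite rmorph_nat.
have redlAo : map_mx (redO l) Ao = A.
  rewrite defA; apply/matrixP=> i j; rewrite !mxE.
  case: ifP => _; last by rewrite rmorph0.
  by case: ifP => _; rewrite -?lam_mu ?rmorph_nat.
pose Br := map_mx (redO r) (lift_mx B).
pose p := redO r piE.
have cenBr (X : 'M[resring L r]_n) :
    mxmult (p ^+ l) (X * Ar - Ar * X) -> mxmult (p ^+ l) (X * Br - Br * X).
  rewrite -(lift_mxK X) -redrAo -!mulmxE -!(map_mxM (redO r)).
  rewrite -!(map_mxB (redO r)) => /(redO_mxmult _ _ l_r).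
  move=> com0; apply/(redO_mxmult _ _ l_r).
  have /cenBA comXB : comm_mx (map_mx (redO l) (lift_mx X)) A.
    apply/eqP; rewrite -subr_eq0 -redlAo -!(map_mxM (redO l)).
    by rewrite -(map_mxB (redO l)) com0.
  by rewrite map_mxB !map_mxM /= lift_mxK comXB subrr.
have pp0 : p ^+ l * p ^+ l = 0 by apply: idgenX_sqr0.
have p_div j (y : resring L r) : (j < l)%N ->
    p ^+ j * y \in multiples (p ^+ j.+1) -> y \in multiples p.
  by move=> lt_jl; apply: redO_idgen_div; lia.
pose Mr := Ar + p *: Br.
pose Pr := map_mx (redO r) (lift_mx P).
have UPr : Pr \in unitmx.
  move: UP; rewrite !unitmxE -{1}(lift_mxK P) (det_map_mx (redO l)).
  by rewrite (det_map_mx (redO r)) !redO_unit.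
have PrV : invmx Pr * Pr = 1 by apply: mulVmx.
have PrK : Pr * invmx Pr = 1 by apply: mulmxV.
pose mE := map_mx (ext_res E (s := r)) m.
(* The conjugation is an equality over [O_l], hence only a congruence over [O_r]; Q below is the
   error. *)
have conjM : mxmult (p ^+ l) (Pr * mE - Mr * Pr).
  pose mo := map_mx (extO E) (lift_mx M).
  have -> : mE = map_mx (redO r) mo.
    by apply/matrixP=> i j; rewrite !mxE ext_res_redO.
  have redlmo : map_mx (redO l) mo = map_mx (ext_res E (s := l)) M.
    by apply/matrixP=> i j; rewrite !mxE -ext_res_redO liftOK.
  have -> : Mr = map_mx (redO r) (Ao + (piE : intring L) *: lift_mx B).
    by rewrite (map_mxD (redO r)) (map_mxZ (redO r)) redrAo.
  rewrite -!mulmxE -!(map_mxM (redO r)) -(map_mxB (redO r)).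
  apply/(redO_mxmult _ _ l_r); rewrite (map_mxB (redO l)) !(map_mxM (redO l)).
  rewrite (map_mxD (redO l)) (map_mxZ (redO l)) redlAo !lift_mxK redlmo.
  by rewrite -defM mulmxKV // subrr.
pose f (g : {'GL_N[R]}) := Pr * map_mx (ext_res E (s := r)) (GLval g) * invmx Pr.
have f1 : f 1%g = 1.
  by rewrite /f (_ : map_mx _ _ = 1) ?mulr1 //; apply: map_mx1.
have fM : {in T &, {morph f : g h / (g * h)%g >-> g * h}}.
  move=> g h _ _; rewrite /f GL_ME -mulmxE (map_mxM (ext_res E (s := r))) !mulmxE.
  by rewrite !mulrA -[_ * invmx Pr * Pr]mulrA PrV mulr1.
have [Q defQ] : exists Q, Pr * mE * invmx Pr = Mr + p ^+ l *: Q.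
  have /mxmultP[Q eQ] := mxmultMr (invmx Pr) conjM; exists Q.
  by rewrite -eQ mulmxE mulrBl -[Mr * _ * _]mulrA PrK mulr1 subrKC.
have f_com : {in T, forall g, mxmult (p ^+ l) (f g * Mr - Mr * f g)}.
  move=> g Tg.
  have := comT g Tg => /mxmultP[C /(congr1 (map_mx (ext_res E (s := r))))].
  rewrite (map_mxB (ext_res E (s := r))) -!mulmxE !(map_mxM (ext_res E (s := r))).
  rewrite (map_mxZ (ext_res E (s := r))) -/mE rmorphXn /= ext_res_redO !mulmxE => comg.
  have -> : Mr = Pr * mE * invmx Pr - p ^+ l *: Q by rewrite defQ addrK.
  rewrite mulrBr mulrBl opprD addrACA -opprD; apply: mxmultB; last first.
    by rewrite -scalerAl -scalerAr -scalerBr; apply: mxmultZ.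
  rewrite /f; set ge := map_mx _ (GLval g) in comg *.
  have -> : Pr * ge * invmx Pr * (Pr * mE * invmx Pr)
      - Pr * mE * invmx Pr * (Pr * ge * invmx Pr)
      = Pr * (ge * mE - mE * ge) * invmx Pr.
    rewrite !mulrA -[_ * invmx Pr * Pr]mulrA -[X in _ - X * ge * _]mulrA PrV.
    by rewrite !mulr1 mulrBr mulrBl !mulrA.
  by rewrite comg; apply/mxmultMr/mxmultMl/mxmultZ.
pose xE := map_mx (ext_res E (s := r)) x.
have fz : f z = 1 + p ^+ l *: (Pr * xE * invmx Pr).
  rewrite /f zE (map_mxD (ext_res E (s := r))) (map_mxZ (ext_res E (s := r))).
  rewrite [map_mx _ 1](map_mx1 (ext_res E (s := r))) rmorphXn /= ext_res_redO.
  by rewrite mulrDr mulr1 mulrDl PrK -scalerAr -scalerAl.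
have := der1_tr0 pos_lt ixK blk_ix pos_ix lam_unit pp0 p_div cenBr f1 fM f_com T'z fz.
rewrite -/Ar -/Mr; have -> : Mr = Pr * mE * invmx Pr - p ^+ l *: Q.
  by rewrite defQ addrK.
rewrite mulrBl raddfB mulrBr /= -scalerAl mxtraceZ [X in _ - X]mulrA pp0 mul0r subr0.
have -> : \tr (Pr * mE * invmx Pr * (Pr * xE * invmx Pr)) = ext_res E (\tr (m * x)).
  rewrite !mulrA -[_ * invmx Pr * Pr]mulrA PrV mulr1 -mulmxE [LHS]mxtrace_mulC.
  by rewrite !mulmxA mulVmx // mul1mx -(map_mxM (ext_res E (s := r))) trace_map_mx.
move=> e; apply/eqP; rewrite -(ext_res_eq0 E) rmorphM rmorphXn /= ext_res_redO.
by rewrite e.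
Qed.

End StableCommutators.

Theorem theorem1p1 (F : fieldType) (K : localField F) (pi : idgen K)
    (psi : F -> algC) (hpsi : additive_char K psi)
    (N l : nat) (hN : (2 <= N)%N) (hl : (1 <= l)%N)
    (M : 'M[resring K l]_(N.-1.+1))
    (chi : 'CF('GL_N[resring K (2 * l)])) :
  chi \in irr 'GL_N[resring K (2 * l)] ->
  stable_char pi psi hl chi ->
  above pi psi hl chi M ->
  let G := 'GL_N[resring K (2 * l)]%G in
  let Kl := congrGL_group pi N (2 * l) l in
  let psiM := psi_char pi psi hl M in
  let T := 'I_G[psiM]%G in
  exists tpsi : 'CF(T),
    [/\ tpsi \is a character,
        'Res[Kl] tpsi = psiM
      & exists2 rho : 'CF(T / Kl),
          rho \in irr (T / Kl) & chi = 'Ind[G] (tpsi * (rho %% Kl)%CF)].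
Proof.
move=> irr_chi [M1 [stM1 aboveM1]] aboveM G Kl psiM T.
have lin (M' : 'M_(N.-1.+1)) : psi_char pi psi hl M' \is a linear_char.
  exact: psi_char_lin.
have nsKG : (Kl <| G)%g := congrGL_normal pi N l.
apply: (irr_above_extendible nsKG irr_chi (lin M) aboveM).
(* The stable matrix [M1] need not be M, but both characters lie below [chi] and so are
   conjugate. *)
apply: (der1_inertia_conj nsKG) _.
  by apply: (irr_above_conj nsKG irr_chi _ _ aboveM1 aboveM); apply: lin_char_irr.
move=> z /setIP[/congrGLP[x zE] T1z].
rewrite (psi_char_tr hpsi _ _ zE); apply: (res_psi_mult0 hpsi hl).
apply: stable_der1_tr stM1 _ T1z zE => // g.
exact: inertia_comm_mult.
Qed.
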